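(* Let $k\ge m\ge 1$ be integers and let $g$ be an estimable parameter of $k$-colored digraphs. Define the graph parameter $g'(G)=\max\{g(L) : L \text{ a } k\text{-colored digraph with } L'=G\}$. Then $g'$ is estimable.
   Context: A $k$-colored digraph is a finite complete digraph (every ordered pair of distinct nodes is an edge) whose edges are colored with colors $1,\dots,k$. Its shadow $L'$ (with respect to $m$) is the simple graph on $V(L)$ in which distinct $u,v$ are adjacent iff at least one of $(u,v),(v,u)$ has a color in $\{1,\dots,m\}$. A bounded graph parameter $f$ (a bounded real function on finite simple graphs invariant under isomorphism) is estimable if for every $\varepsilon,\delta>0$ there is a positive integer $r$ such that for every graph $G$ with at least $r$ nodes, if $X\subseteq V(G)$ is a uniformly random $r$-element set, then $\Pr(|f(G)-f(G[X])|>\varepsilon)<\delta$. Estimable parameters of $k$-colored digraphs (bounded, invariant under color-preserving isomorphism) are defined in the same way, with $G[X]$ the induced colored subdigraph.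
   Formalization: When k = m the maximum defining g'(G) is over an empty set unless G is complete; the formal theorem claims estimability on all graphs for m < k and, for k = m, only on graphs G that are the shadow of some k-colored digraph. *)

(* Defs.v *)
From HB Require Import structures.
From mathcomp Require Import all_boot all_order all_algebra.
From mathcomp Require Import fingroup perm reals.
Set Implicit Arguments. Unset Strict Implicit. Unset Printing Implicit Defensive.
Import Order.TTheory GRing.Theory Num.Theory.
Local Open Scope ring_scope.

(* Finite graphs / colored digraphs are represented on the node set 'I_n
   (every finite node set is in bijection with some 'I_n; all parameters are
   required to be isomorphism invariant). *)

Definition simple_graph n (G : rel 'I_n) : Prop :=
  (forall u v, G u v = G v u) /\ (forall u, G u u = false).

Definition induced_graph n (G : rel 'I_n) (X : {set 'I_n}) : rel 'I_#|X| :=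
  fun i j => G (enum_val i) (enum_val j).
Arguments induced_graph {n} G X _ _.

(** k-colored complete digraphs: colors 1..k are encoded as 'I_k
    (color c+1 <-> ordinal c).  Only off-diagonal entries are meaningful;
    diagonal entries are ignored by isomorphism (see cdg_iso). *)
Definition cdigraph (k n : nat) := {ffun 'I_n * 'I_n -> 'I_k}.

Definition induced_cdg k n (L : cdigraph k n) (X : {set 'I_n}) : cdigraph k #|X| :=
  [ffun p : 'I_#|X| * 'I_#|X| => L (enum_val p.1, enum_val p.2)].
Arguments induced_cdg {k n} L X.

Definition shadow k m n (L : cdigraph k n) : rel 'I_n :=
  fun u v => (u != v) && ((L (u, v) < m)%N || (L (v, u) < m)%N).

Definition is_shadow_of k m n (L : cdigraph k n) (G : rel 'I_n) : bool :=
  [forall u, forall v, shadow m L u v == G u v].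

Section Params.
Variable R : realType.

Definition graph_param (f : forall n, rel 'I_n -> R) : Prop :=
  (exists B : R, forall n (G : rel 'I_n), simple_graph G -> `|f n G| <= B) /\
  (forall n (s : {perm 'I_n}) (G H : rel 'I_n), simple_graph G -> simple_graph H ->
     (forall u v, G (s u) (s v) = H u v) -> f n G = f n H).

(** Parameters of k-colored digraphs: bounded, invariant under
    color-preserving isomorphism (diagonal entries are not part of the digraph). *)
Definition cdg_iso k n (L M : cdigraph k n) (s : {perm 'I_n}) : Prop :=
  forall u v, u != v -> L (s u, s v) = M (u, v).

Definition cdg_param k (g : forall n, cdigraph k n -> R) : Prop :=
  (exists B : R, forall n (L : cdigraph k n), `|g n L| <= B) /\
  (forall n (s : {perm 'I_n}) (L M : cdigraph k n), cdg_iso L M s -> g n L = g n M).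

Definition prob_rsubset n r (P : {set 'I_n} -> bool) : R :=
  (#|[set X : {set 'I_n} | (#|X| == r) && P X]|)%:R / ('C(n, r))%:R.
Arguments prob_rsubset n r P : clear implicits.

Definition graph_estimable_on (D : forall n, rel 'I_n -> Prop)
    (f : forall n, rel 'I_n -> R) : Prop :=
  graph_param f /\
  forall eps delta : R, 0 < eps -> 0 < delta ->
  exists r : nat, (0 < r)%N /\
    forall n (G : rel 'I_n), simple_graph G -> D n G -> (r <= n)%N ->
      prob_rsubset n r
        (fun X => eps < `|f n G - f #|X| (induced_graph G X)|) < delta.

Definition graph_estimable (f : forall n, rel 'I_n -> R) : Prop :=
  graph_estimable_on (fun _ _ => True) f.

Definition cdg_estimable k (g : forall n, cdigraph k n -> R) : Prop :=
  cdg_param g /\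
  forall eps delta : R, 0 < eps -> 0 < delta ->
  exists r : nat, (0 < r)%N /\
    forall n (L : cdigraph k n), (r <= n)%N ->
      prob_rsubset n r
        (fun X => eps < `|g n L - g #|X| (induced_cdg L X)|) < delta.

(** g'(G) = max { g(L) : L' = G }  (an honest maximum of a finite nonempty
    set; the value 0 is only a placeholder when no L has shadow G, which can
    happen only when k = m). *)
Definition shadow_max k m (g : forall n, cdigraph k n -> R) n (G : rel 'I_n) : R :=
  if [pick L : cdigraph k n | is_shadow_of m L G] is Some L0 then
    \big[Num.max/g n L0]_(L : cdigraph k n | is_shadow_of m L G) g n L
  else 0.

End Params.

Definition has_shadow k m n (G : rel 'I_n) : Prop :=
  exists L : cdigraph k n, is_shadow_of m L G.

(* Main.v *)
Require Import Defs.
From HB Require Import structures.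
From mathcomp Require Import all_boot all_order all_algebra.
From mathcomp Require Import fingroup perm reals.
From mathcomp Require Import ring lra.
Set Implicit Arguments. Unset Strict Implicit. Unset Printing Implicit Defensive.
Import Order.TTheory GRing.Theory Num.Theory.
Local Open Scope ring_scope.

(** The substantial direction is [g'(G[X]) <= g'(G) + eps] for a random set [X]
    of [r] nodes.  Let [M] be an optimal colored digraph with shadow [G[X]].
    - Weak (Frieze-Kannan) regularity relative to adjacency gives a partition [P]
      of [X] into boundedly many classes such that, in cut norm, the color of a
      pair looks random with a distribution depending only on its classes and on
      its adjacency.
    - [G] itself has a weakly regular partition [W].  The box norm (4-cycle
      count) of the error and the sizes of the classes are averages over 4- and
      2-tuples, so [W] remains regular and balanced on most sets [X], by Markov's
      inequality.
    - Give each node [v] of [G] a random label with the distribution of [P] on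
      the part of [X] in the [W]-class of [v], then color each pair at random
      from the conditional distribution attached to its labels and adjacency.
      The resulting [L] has shadow [G], and by the counting lemma the expected
      distribution of its [q]-node samples is close to that of [M].
    Some outcome [L] therefore shares a typical [q]-node sample with [M], which
    forces [g(L)] to be close to [g(M)].  No concentration is needed for [L]. *)

(** * Product weights and the counting lemma *)

(** The easy inequality, [g'(G) <= g'(G[X]) + eps], comes from restricting an optimal digraph for
    [G] to [X]. In the other direction [M] is chosen after [X], so no property of [M] can be
    sampled: only statistics of [G] may be asked to survive on [X]. A cut norm is a supremum over
    tests and not an average, hence the detour through the box norm. That norm is polynomial in the
    kernel, nonnegative, at most the cut norm for kernels bounded by 1, and its fourth root bounds
    the cut norm back. This is the origin of the powers [eta ^+ 4]. The order of choices avoids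
    circularity. The test size [q] comes first, then the accuracy [eps1] for [M], which bounds the
    number of classes of [P] uniformly in [X] and [M]; then [eta], small against the square of that
    number; then [W], and [r] last. Regularity of adjacency with respect to [W] tolerates any factor
    depending on labels, at the cost of that square, so [P] may be unrelated to [W]. *)

Section Weights.
Variable R : realFieldType.

Definition prob_weight (U : finType) (w : U -> R) : Prop :=
  (forall x, 0 <= w x) /\ \sum_x w x = 1.

Definition prodw (U : finType) d (w : U -> R) (z : {ffun 'I_d -> U}) : R :=
  \prod_i w (z i).

Definition upd (U : finType) d (z : {ffun 'I_d -> U}) i u : {ffun 'I_d -> U} :=
  [ffun s => if s == i then u else z s].

Lemma prodw_ge0 (U : finType) d (w : U -> R) (z : {ffun 'I_d -> U}) :
  prob_weight w -> 0 <= prodw w z.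
Proof. by move=> [w0 _]; apply: prodr_ge0. Qed.

Lemma sum_prodw (U : finType) d (w : U -> R) :
  prob_weight w -> \sum_(z : {ffun 'I_d -> U}) prodw w z = 1.
Proof.
move=> [_ w1]; rewrite /prodw -(bigA_distr_bigA (fun _ : 'I_d => w)).
by apply: big1 => i _.
Qed.

Lemma norm_wsum (I : finType) (P : pred I) (w F : I -> R) (c : R) :
  (forall i, 0 <= w i) -> \sum_(i | P i) w i <= 1 -> 0 <= c ->
  (forall i, P i -> `|F i| <= c) ->
  `|\sum_(i | P i) w i * F i| <= c.
Proof.
move=> w0 w1 c0 hF; apply: le_trans (ler_norm_sum _ _ _) _.
apply: (@le_trans _ _ (\sum_(i | P i) w i * c)).
  by apply: ler_sum => i Pi; rewrite normrM ger0_norm // ler_wpM2l // hF.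
by rewrite -mulr_suml ler_piMl.
Qed.

(** First-moment method. Positive weight of the outcome matters: a random lift has the right shadow
    only on outcomes of positive probability. *)
Lemma wsum_exists (I : finType) (w F : I -> R) (c : R) :
  prob_weight w -> c <= \sum_i w i * F i -> exists2 i, 0 < w i & c <= F i.
Proof.
move=> [w0 w1] hc.
case: (boolP [exists i, (0 < w i) && (c <= F i)]) => [/existsP[i /andP[]]|].
  by exists i.
rewrite negb_exists => /forallP h; exfalso.
have {}h i : 0 < w i -> F i < c.
  by move=> wi; have := h i; rewrite wi /= -ltNge.
have t0 i : 0 <= w i * (c - F i).
  have := w0 i; rewrite le_eqVlt => /orP[/eqP <-|wi]; first by rewrite mul0r.
  by rewrite mulr_ge0 // subr_ge0 ltW // h.
have : \sum_i w i * (c - F i) <= 0.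
  under eq_bigr do rewrite mulrBr.
  by rewrite sumrB -mulr_suml w1 mul1r subr_le0.
move=> le0; have /eqP : \sum_i w i * (c - F i) = 0.
  by apply/eqP; rewrite eq_le le0 sumr_ge0.
rewrite psumr_eq0 // => /allP hz.
have /eqP := w1; rewrite big1 ?(eq_sym 0) ?oner_eq0 // => i _.
apply/eqP; apply: contraT => wi0.
have wi : 0 < w i by rewrite lt_neqAle eq_sym wi0 w0.
have := hz i; rewrite mem_index_enum => /(_ isT) /=.
by rewrite mulf_eq0 (negbTE wi0) subr_eq0 => /eqP cF; have := h i wi; rewrite -cF ltxx.
Qed.

(** Exchanging the new value [u] with the old entry [z i] is an involution that preserves the weight
    [prodw w z * w u]. *)
Lemma resample (U : finType) d (w : U -> R) (i : 'I_d) (Phi : {ffun 'I_d -> U} -> R) :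
  prob_weight w ->
  \sum_z prodw w z * Phi z = \sum_z prodw w z * \sum_u w u * Phi (upd z i u).
Proof.
move=> [w0 w1]; symmetry.
transitivity (\sum_z \sum_u prodw w z * w u * Phi (upd z i u)).
  by apply: eq_bigr => z _; rewrite mulr_sumr; apply: eq_bigr => u _; rewrite mulrA.
rewrite pair_bigA /=.
pose h (p : {ffun 'I_d -> U} * U) := (upd p.1 i p.2, p.1 i).
have updK z u : upd (upd z i u) i (z i) = z :> {ffun 'I_d -> U}.
  by apply/ffunP => s; rewrite !ffunE; case: eqP => // ->.
have hK : involutive h.
  by case=> z u; rewrite /h /= updK ffunE eqxx.
rewrite (reindex_inj (inv_inj hK)) /=.
transitivity (\sum_z \sum_u prodw w z * w u * Phi z).
  rewrite pair_bigA /=; apply: eq_bigr => -[z u] _ /=; rewrite updK; congr (_ * _).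
  rewrite /prodw (bigD1 i) //= [in RHS](bigD1 i) //= ffunE eqxx.
  under eq_bigr => s si do rewrite ffunE (negbTE si).
  by rewrite mulrAC [w u * _]mulrC -!mulrA; congr (_ * _); rewrite mulrC.
apply: eq_bigr => z _; rewrite -mulr_suml -mulr_sumr w1 mulr1 //.
Qed.

(** Tests are functions into [-1, 1] rather than sets, so that a product of the other factors of a
    pattern, or an average over labels, is again a test. *)
Definition cut_norm_le (U : finType) (w : U -> R) (D : U -> U -> R) (eps : R) : Prop :=
  forall a b : U -> R, (forall x, `|a x| <= 1) -> (forall x, `|b x| <= 1) ->
  `|\sum_x \sum_y w x * w y * (D x y * a x * b y)| <= eps.

Lemma cut_norm_le_ge0 (U : finType) (w : U -> R) D eps : cut_norm_le w D eps -> 0 <= eps.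
Proof.
move=> /(_ (fun=> 0) (fun=> 0)) h; apply: le_trans (h _ _); rewrite ?normr_ge0 //.
  by move=> x; rewrite normr0.
by move=> x; rewrite normr0.
Qed.

(** Once the entries other than [i] and [j] are frozen, [a] is a function of entry [i] alone and [b]
    of entry [j] alone; the cut norm bounds each frozen sum. *)
Lemma cut_norm_le_tuple (U : finType) d (w : U -> R) D eps (i j : 'I_d)
    (a b : {ffun 'I_d -> U} -> R) :
  prob_weight w -> cut_norm_le w D eps -> i != j ->
  (forall z, `|a z| <= 1) -> (forall z, `|b z| <= 1) ->
  (forall z v, a (upd z j v) = a z) -> (forall z u, b (upd z i u) = b z) ->
  `|\sum_z prodw w z * (D (z i) (z j) * a z * b z)| <= eps.
Proof.
move=> pw cut ij a1 b1 aj bi; have e0 := cut_norm_le_ge0 cut.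
rewrite (resample i _ pw) (resample j _ pw).
apply: norm_wsum => //; [by move=> z; exact: prodw_ge0 | by rewrite sum_prodw | ].
move=> z _.
have := cut (fun u => a (upd z i u)) (fun v => b (upd z j v)) _ _.
move=> /(_ (fun _ => a1 _) (fun _ => b1 _)); congr (`|_| <= _).
rewrite exchange_big /=; apply: eq_bigr => v _; rewrite mulr_sumr; apply: eq_bigr => u _.
rewrite [RHS]mulrA [w v * w u]mulrC.
have updC : upd (upd z j v) i u = upd (upd z i u) j v.
  apply/ffunP => s; rewrite !ffunE; case: eqP => // ->.
  by rewrite (negbTE ij).
by rewrite bi {3}updC aj !ffunE !eqxx eq_sym (negbTE ij).
Qed.

Lemma hybrid (I : finType) (Psi : {set I} -> R) eps :
  (forall (S : {set I}) e, e \notin S -> `|Psi (e |: S) - Psi S| <= eps) ->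
  `|Psi setT - Psi set0| <= #|I|%:R * eps.
Proof.
move=> h; rewrite -cardsT; move: [set: I] => S.
have [n] := ubnP #|S|; elim: n S => // n IH S.
case: (set_0Vmem S) => [->|[e eS]].
  by rewrite subrr normr0 cards0 mul0r.
rewrite -(setD1K eS) cardsU1 !inE eqxx /= add1n ltnS => lt.
have /IH le1 := lt; have := h (S :\ e) e; rewrite !inE eqxx => /(_ isT) le2.
have -> : Psi (e |: S :\ e) - Psi set0 =
  (Psi (e |: S :\ e) - Psi (S :\ e)) + (Psi (S :\ e) - Psi set0) by rewrite addrA subrK.
apply: le_trans (ler_normD _ _) _.
by rewrite -natr1 mulrDl mul1r [leRHS]addrC lerD.
Qed.

Lemma norm_prod_le1 (I : Type) (s : seq I) (P : pred I) (F : I -> R) :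
  (forall i, 0 <= F i <= 1) -> `|\prod_(i <- s | P i) F i| <= 1.
Proof.
move=> h.
suff /andP[p0 p1] : 0 <= \prod_(i <- s | P i) F i <= 1 by rewrite ger0_norm.
apply: (big_ind (fun x : R => 0 <= x <= 1)) => [|x y /andP[x0 x1] /andP[y0 y1]|i _]; rewrite ?ler01 ?lexx //.
by rewrite mulr_ge0 // mulr_ile1.
Qed.

(** The factors [A e] are exchanged for [B e] one pair at a time; each exchange costs one cut
    norm. *)
Lemma counting (U : finType) q (w : U -> R) (A B : 'I_q * 'I_q -> U -> U -> R) (eps : R) :
  prob_weight w -> 0 <= eps ->
  (forall e x y, 0 <= A e x y <= 1) -> (forall e x y, 0 <= B e x y <= 1) ->
  (forall e : 'I_q * 'I_q, (e.1 < e.2)%N -> cut_norm_le w (fun x y => A e x y - B e x y) eps) ->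
  `|\sum_z prodw w z * \prod_(e : 'I_q * 'I_q | (e.1 < e.2)%N) A e (z e.1) (z e.2)
    - \sum_z prodw w z * \prod_(e : 'I_q * 'I_q | (e.1 < e.2)%N) B e (z e.1) (z e.2)|
  <= (q * q)%:R * eps.
Proof.
move=> pw e0 A1 B1 cut.
pose C (S : {set 'I_q * 'I_q}) e x y := if e \in S then A e x y else B e x y.
pose Psi S := \sum_(z : {ffun 'I_q -> U}) prodw w z *
  \prod_(e : 'I_q * 'I_q | (e.1 < e.2)%N) C S e (z e.1) (z e.2).
have C1 S e x y : 0 <= C S e x y <= 1 by rewrite /C; case: ifP.
have := @hybrid _ Psi eps; rewrite card_prod card_ord.
have -> : Psi setT = \sum_(z : {ffun 'I_q -> U}) prodw w z * \prod_(e : 'I_q * 'I_q | (e.1 < e.2)%N) A e (z e.1) (z e.2).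
  by apply: eq_bigr => z _; congr (_ * _); apply: eq_bigr => e _; rewrite /C inE.
have -> : Psi set0 = \sum_(z : {ffun 'I_q -> U}) prodw w z * \prod_(e : 'I_q * 'I_q | (e.1 < e.2)%N) B e (z e.1) (z e.2).
  by apply: eq_bigr => z _; congr (_ * _); apply: eq_bigr => e _; rewrite /C inE.
apply=> S [i j] eS.
case: (boolP (i < j)%N) => ij; last first.
  have -> : Psi ((i, j) |: S) = Psi S.
    apply: eq_bigr => z _; congr (_ * _); apply: eq_bigr => e he.
    rewrite /C !inE; case: eqP => // ee.
    by move: he; rewrite ee /= (negbTE ij).
  by rewrite subrr normr0.
(* The factors avoiding [j] form the test on entry [i]. Every other factor besides [(i, j)] itself
   contains [j], hence not [i], and goes to the test on entry [j]. *)
pose a (z : {ffun 'I_q -> U}) :=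
  \prod_(e : 'I_q * 'I_q | [&& (e.1 < e.2)%N, e != (i, j) & (e.1 != j) && (e.2 != j)])
    C S e (z e.1) (z e.2).
pose b (z : {ffun 'I_q -> U}) :=
  \prod_(e : 'I_q * 'I_q | [&& (e.1 < e.2)%N, e != (i, j) & ~~ ((e.1 != j) && (e.2 != j))])
    C S e (z e.1) (z e.2).
have key (z : {ffun 'I_q -> U}) S' : (forall e, e != (i, j) -> C S' e = C S e) ->
    \prod_(e : 'I_q * 'I_q | (e.1 < e.2)%N) C S' e (z e.1) (z e.2) =
    C S' (i, j) (z i) (z j) * a z * b z.
  move=> hS'; rewrite (bigD1 (i, j)) //= -mulrA; congr (_ * _).
  under eq_bigr => e /andP[_ he] do rewrite hS' //.
  rewrite (bigID (fun e : 'I_q * 'I_q => (e.1 != j) && (e.2 != j))) /=.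
  by congr (_ * _); apply: eq_bigl => e; rewrite -andbA.
rewrite -sumrB.
under eq_bigr => z _.
  rewrite (key z S) // (key z ((i, j) |: S)); last first.
    by move=> e he; rewrite /C !inE (negbTE he).
  rewrite /C !inE eqxx (negbTE eS) /= -mulrBr -!mulrBl.
over.
apply: (@cut_norm_le_tuple U q w (fun x y => A (i, j) x y - B (i, j) x y) eps i j a b) => //.
- by apply: cut.
- by rewrite neq_ltn ij.
- by move=> z; apply: norm_prod_le1 => e; apply: C1.
- by move=> z; apply: norm_prod_le1 => e; apply: C1.
- move=> z v; apply: eq_bigr => e /and3P[_ _ /andP[h1 h2]].
  by rewrite !ffunE (negbTE h1) (negbTE h2).
- move=> z u; apply: eq_bigr => -[s t] /= /and3P[st ne h].
  rewrite !ffunE; case: (eqVneq s i) => [si|_].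
    subst s; move: h ne; rewrite negb_and !negbK => /orP[/eqP ee|/eqP ->].
      by move: ij; rewrite ee ltnn.
    by rewrite eqxx.
  case: (eqVneq t i) => [ti|//]; subst t.
  move: h; rewrite negb_and !negbK => /orP[/eqP ee|/eqP ee].
    by move: st; rewrite ee ltnNge ltnW.
  by move: ij; rewrite ee ltnn.
Qed.

(** The variation distance is subadditive over independent coordinates, which are switched from [nu]
    to [mu] one by one. *)
Lemma product_tv (S : finType) q (mu nu : S -> R) (Phi : {ffun 'I_q -> S} -> R) :
  prob_weight mu -> prob_weight nu -> (forall s, 0 <= Phi s <= 1) ->
  `|\sum_s prodw mu s * Phi s - \sum_s prodw nu s * Phi s|
  <= q%:R * \sum_x `|mu x - nu x|.
Proof.
move=> [mu0 mu1] [nu0 nu1] Phi1.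
pose om (A : {set 'I_q}) i x := if i \in A then mu x else nu x.
pose Psi A := \sum_(s : {ffun 'I_q -> S}) (\prod_i om A i (s i)) * Phi s.
have om1 A i : \sum_x om A i x = 1.
  by rewrite /om; case: (i \in A).
have := @hybrid _ Psi (\sum_x `|mu x - nu x|); rewrite card_ord.
have -> : Psi setT = \sum_s prodw mu s * Phi s.
  by apply: eq_bigr => z _; congr (_ * _); apply: eq_bigr => e _; rewrite /om inE.
have -> : Psi set0 = \sum_s prodw nu s * Phi s.
  by apply: eq_bigr => z _; congr (_ * _); apply: eq_bigr => e _; rewrite /om inE.
apply=> A k kA; rewrite -sumrB.
apply: le_trans (ler_norm_sum _ _ _) _.
(* This majorant is still a product, so its sum factors and every coordinate but [k] contributes
   1. *)
pose ab i x := if i == k then `|mu x - nu x| else om A i x.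
apply: (@le_trans _ _ (\sum_(s : {ffun 'I_q -> S}) \prod_i ab i (s i))).
  apply: ler_sum => s _; rewrite -mulrBl normrM.
  have /andP[p0 p1] := Phi1 s; rewrite (ger0_norm p0).
  apply: le_trans (ler_piMr (normr_ge0 _) p1) _.
  rewrite (bigD1 k) //= [\prod_i om A i _](bigD1 k) //= [leRHS](bigD1 k) //=.
  rewrite {1}/om !inE eqxx /= {2}/om (negbTE kA).
  have -> : \prod_(i < q | i != k) om (k |: A) i (s i) = \prod_(i < q | i != k) om A i (s i).
    by apply: eq_bigr => i ik; rewrite /om !inE (negbTE ik).
  have -> : \prod_(i < q | i != k) ab i (s i) = \prod_(i < q | i != k) om A i (s i).
    by apply: eq_bigr => i ik; rewrite /ab (negbTE ik).
  rewrite -mulrBl normrM /ab eqxx ler_wpM2l // ger0_norm //.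
  by apply: prodr_ge0 => i _; rewrite /om; case: ifP.
rewrite -(bigA_distr_bigA ab) (bigD1 k) //= [X in _ * X]big1 ?mulr1 ?/ab ?eqxx //.
by move=> i ik; rewrite (negbTE ik).
Qed.

Definition pushw (U S : finType) (psi : U -> S) (w : U -> R) s : R :=
  \sum_(u | psi u == s) w u.

Lemma pushw_prob (U S : finType) (psi : U -> S) w :
  prob_weight w -> prob_weight (pushw psi w).
Proof.
move=> [w0 w1]; split; first by move=> s; apply: sumr_ge0.
by rewrite -w1 (partition_big psi xpredT).
Qed.

Lemma push_tuple (U S : finType) (psi : U -> S) w q (Phi : {ffun 'I_q -> S} -> R) :
  \sum_(z : {ffun 'I_q -> U}) prodw w z * Phi [ffun i => psi (z i)] =
  \sum_s prodw (pushw psi w) s * Phi s.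
Proof.
rewrite (partition_big (fun z : {ffun 'I_q -> U} => [ffun i => psi (z i)]) xpredT) //=.
apply: eq_bigr => s _.
rewrite (eq_bigr (fun z => prodw w z * Phi s)); last by move=> z /eqP ->.
rewrite -mulr_suml; congr (_ * _).
rewrite /prodw /pushw (bigA_distr_big_dep (fun (i : 'I_q) u => psi u == s i) (fun _ u => w u)).
apply: eq_bigl => z; apply/eqP/familyP => [<- i|h].
  by rewrite unfold_in ffunE.
by apply/ffunP => i; rewrite ffunE; apply/eqP; have := h i; rewrite unfold_in.
Qed.

(** Independence of the values of a random function: the factors read distinct coordinates, and a
    coordinate that is not read sums to 1. It serves both for colors of pairs and for labels of
    nodes. *)
Lemma indep_prod (I J D : finType) (w : I -> J -> R) (P : pred D) (iota : D -> I)
    (phi : D -> J -> R) :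
  (forall i, \sum_j w i j = 1) -> {in P &, injective iota} ->
  \sum_(f : {ffun I -> J}) (\prod_i w i (f i)) * \prod_(s | P s) phi s (f (iota s)) =
  \prod_(s | P s) \sum_j w (iota s) j * phi s j.
Proof.
move=> w1 inj.
transitivity (\sum_(f : {ffun I -> J})
    \prod_i (w i (f i) * \prod_(s | P s && (iota s == i)) phi s (f i))).
  apply: eq_bigr => f _; rewrite big_split /=; congr (_ * _).
  rewrite (partition_big iota xpredT) //=; apply: eq_bigr => i _.
  by apply: eq_bigr => s /andP[_ /eqP ->].
rewrite -(bigA_distr_bigA (fun i j => w i j * \prod_(s | P s && (iota s == i)) phi s j)).
rewrite [RHS](partition_big iota xpredT) //=; apply: eq_bigr => i _.
case: (pickP (fun s => P s && (iota s == i))) => [s /andP[Ps /eqP si]|none].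
  have u1 t : P t && (iota t == i) = (t == s).
    apply/andP/eqP => [[Pt /eqP ti]|->]; last by rewrite si.
    by apply: inj => //; rewrite ti.
  rewrite (eq_bigl (pred1 s)) // big_pred1_eq si.
  by apply: eq_bigr => j _; rewrite (eq_bigl (pred1 s)) // big_pred1_eq.
rewrite [RHS]big_pred0 //; apply: eq_trans (w1 i); apply: eq_bigr => j _.
by rewrite big_pred0 ?mulr1.
Qed.

End Weights.

(** * Weak regularity *)

Section Regularity.
Variable R : realFieldType.

Lemma sqr_wsum_le (I : finType) (w g : I -> R) :
  prob_weight w -> (\sum_i w i * g i) ^+ 2 <= \sum_i w i * g i ^+ 2.
Proof.
move=> [w0 w1]; set m := \sum_i w i * g i.
have : 0 <= \sum_i w i * (g i - m) ^+ 2.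
  by apply: sumr_ge0 => i _; rewrite mulr_ge0 ?sqr_ge0.
rewrite (eq_bigr (fun i => w i * g i ^+ 2 - 2 * m * (w i * g i) + m ^+ 2 * w i));
  last by move=> i _; ring.
by rewrite big_split sumrB /= -!mulr_sumr w1 -/m; lra.
Qed.

Definition sum2 (U : finType) (w : U -> R) (g : U -> U -> R) : R :=
  \sum_x \sum_y w x * w y * g x y.

Section Sum2.
Variables (U : finType) (w : U -> R).
Hypothesis pw : prob_weight w.
Implicit Types g : U -> U -> R.

Lemma eq_sum2 g1 g2 : (forall x y, g1 x y = g2 x y) -> sum2 w g1 = sum2 w g2.
Proof. by move=> e; do 2!apply: eq_bigr => ? _; rewrite e. Qed.

Lemma sum2D g1 g2 : sum2 w (fun x y => g1 x y + g2 x y) = sum2 w g1 + sum2 w g2.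
Proof.
rewrite -big_split; apply: eq_bigr => x _; rewrite -big_split.
by apply: eq_bigr => y _; rewrite mulrDr.
Qed.

Lemma sum2Z k g : sum2 w (fun x y => k * g x y) = k * sum2 w g.
Proof.
rewrite mulr_sumr; apply: eq_bigr => x _; rewrite mulr_sumr.
by apply: eq_bigr => y _; rewrite mulrCA.
Qed.

Lemma sum2B g1 g2 : sum2 w (fun x y => g1 x y - g2 x y) = sum2 w g1 - sum2 w g2.
Proof.
rewrite -mulN1r -sum2Z -sum2D; apply: eq_sum2 => x y; by rewrite mulN1r.
Qed.

Lemma sum2N g : sum2 w (fun x y => - g x y) = - sum2 w g.
Proof. by rewrite -mulN1r -sum2Z; apply: eq_sum2 => x y; rewrite mulN1r. Qed.

Lemma ler_sum2 g1 g2 : (forall x y, g1 x y <= g2 x y) -> sum2 w g1 <= sum2 w g2.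
Proof.
move=> h; do 2!apply: ler_sum => ? _; case: pw => w0 _.
by rewrite ler_wpM2l // mulr_ge0.
Qed.

Lemma sum2_cst k : sum2 w (fun _ _ => k) = k.
Proof.
case: pw => w0 w1; rewrite -[RHS]mul1r -w1 mulr_suml; apply: eq_bigr => x _.
by rewrite -mulr_suml -mulr_sumr w1 mulr1.
Qed.

Lemma prob_pair : prob_weight (fun p : U * U => w p.1 * w p.2).
Proof.
case: pw => w0 w1; split=> [p|]; first by rewrite mulr_ge0.
rewrite -(pair_bigA _ (fun x y => w x * w y)) /= -w1.
by apply: eq_bigr => x _; rewrite -mulr_sumr w1 mulr1.
Qed.

Lemma sqr_sum2_le g : sum2 w g ^+ 2 <= sum2 w (fun x y => g x y ^+ 2).
Proof.
rewrite /sum2 !pair_bigA /=.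
exact: (sqr_wsum_le (fun p => g p.1 p.2) prob_pair).
Qed.

Lemma sum2_swap g : sum2 w (fun x y => g y x) = sum2 w g.
Proof.
rewrite /sum2 exchange_big; do 2!apply: eq_bigr => ? _.
by rewrite [w _ * w _]mulrC.
Qed.

(** The form is linear in [a] for fixed [b], so replacing [a] by the indicator of the points with
    positive coefficient can only increase it; then likewise for [b]. *)
Lemma sum2_sets_onesided g (eps : R) (a b : U -> R) :
  (forall S T : {set U}, sum2 w (fun x y => g x y * (x \in S)%:R * (y \in T)%:R) <= eps) ->
  (forall x, 0 <= a x <= 1) -> (forall x, 0 <= b x <= 1) ->
  sum2 w (fun x y => g x y * a x * b y) <= eps.
Proof.
move=> h a1 b1.
have left f (c : U -> R) : (forall x, 0 <= c x <= 1) -> exists S : {set U},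
    sum2 w (fun x y => f x y * c x) <= sum2 w (fun x y => f x y * (x \in S)%:R).
  move=> c1; pose s x := \sum_y w x * w y * f x y.
  exists [set x | 0 < s x]; apply: ler_sum => x _.
  under eq_bigr do rewrite mulrA; under [leRHS]eq_bigr do rewrite mulrA.
  rewrite -!mulr_suml -/(s x) inE; have /andP[c0 cx] := c1 x.
  case: ltP => sx; first by rewrite ler_wpM2l // ltW.
  by rewrite mulr0 mulr_le0_ge0.
have [S hS] := left (fun x y => g x y * b y) a a1.
have [T hT] := left (fun y x => g x y * (x \in S)%:R) b b1.
apply: le_trans (h S T).
rewrite (eq_sum2 (g2 := fun x y => g x y * b y * a x)); last by move=> x y; rewrite mulrAC.
apply: le_trans hS _; rewrite -sum2_swap.
rewrite (eq_sum2 (g2 := fun y x => g x y * (x \in S)%:R * b y));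
  last by move=> x y; rewrite mulrAC.
by apply: le_trans hT _; rewrite -sum2_swap.
Qed.

Lemma cut_norm_le_of_sets g (eps : R) :
  (forall S T : {set U}, `|sum2 w (fun x y => g x y * (x \in S)%:R * (y \in T)%:R)| <= eps) ->
  cut_norm_le w g (4 * eps).
Proof.
move=> h a b ha hb.
have h01 (a' b' : U -> R) : (forall x, 0 <= a' x <= 1) -> (forall x, 0 <= b' x <= 1) ->
    `|sum2 w (fun x y => g x y * a' x * b' y)| <= eps.
  move=> a1 b1; rewrite ler_norml lerNl -sum2N; apply/andP; split.
    rewrite (eq_sum2 (g2 := fun x y => (- g x y) * a' x * b' y));
      last by move=> x y; rewrite !mulNr.
    apply: sum2_sets_onesided => // S T.
    rewrite (eq_sum2 (g2 := fun x y => - (g x y * (x \in S)%:R * (y \in T)%:R)));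
      last by move=> x y; rewrite !mulNr.
    by rewrite sum2N; have := h S T; rewrite ler_norml lerNl => /andP[].
  by apply: sum2_sets_onesided => // S T; have := h S T; rewrite ler_norml => /andP[].
(* Since [a = ap - am] and [b = bp - bm], the form splits into four with tests in [0, 1], whence the
   factor 4. *)
pose ap x := (1 + a x) / 2; pose am x := (1 - a x) / 2.
pose bp x := (1 + b x) / 2; pose bm x := (1 - b x) / 2.
have ap1 x : 0 <= ap x <= 1 by have := ha x; rewrite ler_norml /ap; lra.
have am1 x : 0 <= am x <= 1 by have := ha x; rewrite ler_norml /am; lra.
have bp1 x : 0 <= bp x <= 1 by have := hb x; rewrite ler_norml /bp; lra.
have bm1 x : 0 <= bm x <= 1 by have := hb x; rewrite ler_norml /bm; lra.
have -> : \sum_x \sum_y w x * w y * (g x y * a x * b y) =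
   (sum2 w (fun x y => g x y * ap x * bp y) - sum2 w (fun x y => g x y * ap x * bm y)) -
   (sum2 w (fun x y => g x y * am x * bp y) - sum2 w (fun x y => g x y * am x * bm y)).
  by rewrite -!sum2B; apply: eq_sum2 => x y; rewrite /ap /am /bp /bm; field.
have := h01 _ _ ap1 bp1; have := h01 _ _ ap1 bm1.
have := h01 _ _ am1 bp1; have := h01 _ _ am1 bm1.
rewrite !ler_norml => /andP[l1 u1] /andP[l2 u2] /andP[l3 u3] /andP[l4 u4].
by apply/andP; split; lra.
Qed.

End Sum2.
Arguments eq_sum2 {U w g1 g2} _.

Section Blocks.
Variables (U : finType) (w : U -> R).
Hypothesis pw : prob_weight w.

Definition block (Lb : finType) (P : U -> Lb) (g : U -> U -> R) i j : R :=
  \sum_(x | P x == i) \sum_(y | P y == j) w x * w y * g x y.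

(* [0] on blocks where [h] vanishes. *)
Definition density (Lb : finType) (P : U -> Lb) (f h : U -> U -> R) i j : R :=
  block P f i j / block P h i j.

Lemma sum2_block (Lb : finType) (P : U -> Lb) (g : U -> U -> R) (s : Lb -> Lb -> R) :
  sum2 w (fun x y => g x y * s (P x) (P y)) = \sum_i \sum_j block P g i j * s i j.
Proof.
rewrite /sum2 (partition_big P xpredT) //=; apply: eq_bigr => i _.
rewrite exchange_big /= (partition_big P xpredT) //=; apply: eq_bigr => j _.
rewrite exchange_big /= mulr_suml; apply: eq_bigr => x /eqP <-.
by rewrite mulr_suml; apply: eq_bigr => y /eqP <-; rewrite mulrA.
Qed.

Section Density.
Variables (f h : U -> U -> R).
Hypothesis f0 : forall x y, 0 <= f x y.
Hypothesis fh : forall x y, f x y <= h x y.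
Hypothesis h1 : forall x y, h x y <= 1.

Let w0 x : 0 <= w x. Proof. by case: pw. Qed.

Lemma block_ge0 (Lb : finType) (P : U -> Lb) i j : 0 <= block P f i j.
Proof. by do 2!apply: sumr_ge0 => ? _; rewrite !mulr_ge0. Qed.

Lemma block_le (Lb : finType) (P : U -> Lb) i j : block P f i j <= block P h i j.
Proof. by do 2!apply: ler_sum => ? _; rewrite ler_wpM2l ?mulr_ge0. Qed.

Lemma density_bounds (Lb : finType) (P : U -> Lb) i j : 0 <= density P f h i j <= 1.
Proof.
have b0 := block_ge0 P i j; have bl := block_le P i j.
have h0 := le_trans b0 bl; rewrite /density divr_ge0 //=.
move: h0; rewrite le_eqVlt => /orP[/eqP e|hp]; last by rewrite ler_pdivrMr // mul1r.
by rewrite -e invr0 mulr0.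
Qed.

Lemma density_block (Lb : finType) (P : U -> Lb) i j :
  block P h i j * density P f h i j = block P f i j.
Proof.
rewrite /density; have b0 := block_ge0 P i j; have bl := block_le P i j.
case: (eqVneq (block P h i j) 0) => [e|ne]; last by rewrite mulrC divfK.
by rewrite e mul0r; apply/eqP; rewrite eq_le b0 -e bl.
Qed.

(** [h] times the density acts as the projection of [f] onto block functions: it cannot be told from
    [f] by a function of the classes. *)
Lemma sum2_density (Lb : finType) (P : U -> Lb) (s : Lb -> Lb -> R) :
  sum2 w (fun x y => h x y * density P f h (P x) (P y) * s (P x) (P y)) =
  sum2 w (fun x y => f x y * s (P x) (P y)).
Proof.
rewrite (sum2_block P f).
rewrite (eq_sum2 (g2 := fun x y => h x y * (density P f h (P x) (P y) * s (P x) (P y))));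
  last by move=> x y; rewrite mulrA.
rewrite (sum2_block P h (fun i j => density P f h i j * s i j)).
by do 2!apply: eq_bigr => ? _; rewrite mulrA density_block.
Qed.

Definition energy (Lb : finType) (P : U -> Lb) : R :=
  sum2 w (fun x y => h x y * density P f h (P x) (P y) ^+ 2).

Let h0 x y : 0 <= h x y. Proof. exact: le_trans (f0 x y) (fh x y). Qed.

Lemma energy_le1 (Lb : finType) (P : U -> Lb) : energy P <= 1.
Proof.
rewrite -(sum2_cst pw 1); apply: ler_sum2 => // x y.
have /andP[d0 d1] := density_bounds P (P x) (P y).
by rewrite mulr_ile1 ?sqr_ge0 ?exprn_ile1.
Qed.

(** Pythagoras in the [h]-weighted inner product: the coarse density is the projection of the fine
    one, so the cross term equals the coarse energy. *)
Lemma energy_refine (Lb Lb' : finType) (P : U -> Lb) (P' : U -> Lb') (pi : Lb' -> Lb) :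
  (forall x, P x = pi (P' x)) ->
  energy P' - energy P =
  sum2 w (fun x y =>
    h x y * (density P' f h (P' x) (P' y) - density P f h (P x) (P y)) ^+ 2).
Proof.
move=> hpi; set p := density P f h; set p' := density P' f h.
have cross : sum2 w (fun x y => h x y * p' (P' x) (P' y) * p (P x) (P y)) = energy P.
  rewrite (eq_sum2 (g2 := fun x y => h x y * p' (P' x) (P' y) * p (pi (P' x)) (pi (P' y))));
    last by move=> x y; rewrite !hpi.
  rewrite (sum2_density P' (fun i j => p (pi i) (pi j))).
  rewrite (eq_sum2 (g2 := fun x y => f x y * p (P x) (P y)));
    last by move=> x y; rewrite !hpi.
  by rewrite -sum2_density; apply: eq_sum2 => x y; rewrite expr2 mulrA.
rewrite (eq_sum2 (g1 := fun x y => h x y * _ ^+ 2) (g2 := fun x y =>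
  (h x y * p' (P' x) (P' y) ^+ 2 + h x y * p (P x) (P y) ^+ 2)
   - 2 * (h x y * p' (P' x) (P' y) * p (P x) (P y))));
   last by move=> x y; ring.
by rewrite sum2B sum2D sum2Z cross -/(energy P) -/(energy P'); lra.
Qed.

Lemma energy_mono (Lb Lb' : finType) (P : U -> Lb) (P' : U -> Lb') (pi : Lb' -> Lb) :
  (forall x, P x = pi (P' x)) -> energy P <= energy P'.
Proof.
move=> hpi; rewrite -subr_ge0 (energy_refine hpi) -(sum2_cst pw 0).
by apply: ler_sum2 => // x y; rewrite mulr_ge0 ?sqr_ge0.
Qed.

(** The rectangle is a union of refined blocks, so [f] may be replaced by its refined projection in
    the discrepancy. Cauchy-Schwarz and [h ^+ 2 <= h] then bound the square by the gain given by
    [energy_refine]. *)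
Lemma energy_gain (Lb : finType) (P : U -> Lb) (S T : {set U}) :
  sum2 w (fun x y => (f x y - h x y * density P f h (P x) (P y))
    * (x \in S)%:R * (y \in T)%:R) ^+ 2
  <= energy (fun x => (P x, (x \in S, x \in T))) - energy P.
Proof.
pose P' (x : U) := (P x, (x \in S, x \in T)); rewrite -/P'.
rewrite (@energy_refine _ _ P P' (fun l => l.1)) //.
set p := density P f h; set p' := density P' f h.
have -> : sum2 w (fun x y => (f x y - h x y * p (P x) (P y)) * (x \in S)%:R * (y \in T)%:R)
  = sum2 w (fun x y => h x y * (p' (P' x) (P' y) - p (P x) (P y)) *
       ((x \in S)%:R * (y \in T)%:R)).
  rewrite (eq_sum2 (g2 := fun x y => f x y * ((x \in S)%:R * (y \in T)%:R)
     - h x y * p (P x) (P y) * ((x \in S)%:R * (y \in T)%:R))); last by move=> x y; ring.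
  rewrite sum2B -(sum2_density P' (fun i j => i.2.1%:R * j.2.2%:R)) -sum2B.
  by apply: eq_sum2 => x y /=; rewrite -/p'; ring.
apply: le_trans (sqr_sum2_le pw _) _; apply: ler_sum2 => // x y.
have hh : h x y ^+ 2 <= h x y by rewrite expr2 ler_piMr.
have : 0 <= ((x \in S)%:R * (y \in T)%:R : R) ^+ 2 <= 1.
  by case: (x \in S); case: (y \in T); rewrite ?mulr0 ?mul0r ?mulr1 ?expr0n ?expr1n ?lexx ?ler01.
move=> /andP[i0 i1]; rewrite !exprMn.
rewrite -[X in X * _ * _]/(h x y ^+ 2).
apply: le_trans (_ : h x y ^+ 2 * (p' (P' x) (P' y) - p (P x) (P y)) ^+ 2 <= _).
  by rewrite exprMn in i1 *; rewrite ler_piMr // mulr_ge0 ?sqr_ge0.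
by rewrite ler_wpM2r ?sqr_ge0.
Qed.

End Density.
End Blocks.

(** The energies summed over [c] stay below [#|C|], so fewer than [N] refinements occur, each
    cutting a class into at most four. The bound on the number of classes is independent of [U] and
    one partition serves all [c]. It is applied with [h] the adjacency indicator for the colors of
    [M], and with [h = 1] for [G]. *)
Lemma weak_regularity (C : finType) (eps : R) (N : nat) : 0 < eps ->
  #|C|%:R < N%:R * (eps / 4) ^+ 2 ->
  forall (U : finType) (w : U -> R) (f h : C -> U -> U -> R), prob_weight w ->
  (forall c x y, 0 <= f c x y) -> (forall c x y, f c x y <= h c x y) ->
  (forall c x y, h c x y <= 1) ->
  exists (Lb : finType) (P : U -> Lb), (#|Lb| <= 4 ^ N)%N /\
  forall c, cut_norm_le w (fun x y =>
    f c x y - h c x y * density w P (f c) (h c) (P x) (P y)) eps.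
Proof.
move=> e0 hN U w f h pw f0 fh h1.
pose E (Lb : finType) (P : U -> Lb) := \sum_c energy w (f c) (h c) P.
(* Splitting by a rectangle that violates the bound increases the energy by
   [(eps / 4) ^+ 2]. *)
have step t : (exists (Lb : finType) (P : U -> Lb), (#|Lb| <= 4 ^ t)%N /\
      forall c, cut_norm_le w (fun x y =>
      f c x y - h c x y * density w P (f c) (h c) (P x) (P y)) eps) \/
    (exists (Lb : finType) (P : U -> Lb), (#|Lb| <= 4 ^ t)%N /\
      t%:R * (eps / 4) ^+ 2 <= E Lb P).
  elim: t => [|t [] [Lb [P [cL hP]]]].
  - right; exists unit, (fun=> tt); split; first by rewrite card_unit.
    rewrite mul0r; apply: sumr_ge0 => c _; rewrite -(sum2_cst pw 0); apply: ler_sum2 => // x y.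
    by rewrite mulr_ge0 ?sqr_ge0 // (le_trans (f0 c x y)).
  - by left; exists Lb, P; split=> //; rewrite (leq_trans cL) // leq_exp2l.
  case: (boolP [forall c, forall S : {set U}, forall T : {set U},
     `|sum2 w (fun x y => (f c x y - h c x y * density w P (f c) (h c) (P x) (P y))
      * (x \in S)%:R * (y \in T)%:R)| <= eps / 4]).
    move=> /forallP reg; left; exists Lb, P; split.
      by rewrite (leq_trans cL) // leq_exp2l.
    move=> c; have := reg c => /forallP reg'.
    have -> : eps = 4 * (eps / 4) by rewrite mulrC divfK ?pnatr_eq0.
    by apply: cut_norm_le_of_sets => // S T; have /forallP := reg' S; apply.
  rewrite negb_forall => /existsP[c]; rewrite negb_forall => /existsP[S].
  rewrite negb_forall => /existsP[T]; rewrite -ltNge => irr.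
  right; exists (Lb * (bool * bool))%type, (fun x => (P x, (x \in S, x \in T))).
  split; first by rewrite !card_prod card_bool expnSr leq_mul.
  rewrite -natr1 mulrDl mul1r.
  apply: (@le_trans _ _ (E Lb P + (energy w (f c) (h c) (fun x => (P x, (x \in S, x \in T)))
    - energy w (f c) (h c) P))).
    apply: lerD => //; apply: le_trans (energy_gain pw (f0 c) (fh c) (h1 c) P S T).
    rewrite -[leRHS]real_normK ?num_real // lerXn2r ?nnegrE ?normr_ge0 ?divr_ge0 ?ltW //.
  rewrite /E (bigD1 c) //= [leRHS](bigD1 c) //=.
  have tele (p p' s s' : R) : s <= s' -> p + s + (p' - p) <= p' + s' by lra.
  apply: tele; apply: ler_sum => c' _.
  exact: (@energy_mono U w pw (f c') (h c') (f0 c') (fh c') _ _ _ _ (fun l => l.1)).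
case: (step N) => // -[Lb [P [_ hP]]]; exfalso.
have : E Lb P <= #|C|%:R.
  by rewrite -sumr_const; apply: ler_sum => c _; exact: energy_le1.
by move=> /(le_trans hP); rewrite leNgt hN.
Qed.

End Regularity.

(** * Box norm and random subsets *)

Section Box.
Variable R : realFieldType.
Variables (U : finType) (w : U -> R).
Hypothesis pw : prob_weight w.

Definition codegree (B : U -> U -> R) y y' : R := \sum_x w x * (B x y * B x y').

(* The fourth power of Gowers' box norm. *)
Definition box (B : U -> U -> R) : R := sum2 w (fun y y' => codegree B y y' ^+ 2).

Lemma box_ge0 B : 0 <= box B.
Proof. by rewrite -(sum2_cst pw 0); apply: ler_sum2 => // x y; rewrite sqr_ge0. Qed.

Lemma norm_mul_le1 (x y : R) : `|x| <= 1 -> `|y| <= 1 -> `|x * y| <= 1.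
Proof. by move=> h1 h2; rewrite normrM mulr_ile1. Qed.

(** Two opposite vertices [x'], [y'] of the 4-cycle are frozen; the other three edges then split
    into a test in [x] and a test in [y] for the kernel [B x y]. *)
Lemma box_le_cut B eps : (forall x y, `|B x y| <= 1) -> cut_norm_le w B eps -> box B <= eps.
Proof.
move=> B1 cut.
have -> : box B = sum2 w (fun x' y' =>
    sum2 w (fun x y => B x y * B x y' * (B x' y * B x' y'))).
  rewrite /box /sum2.
  transitivity (\sum_y' \sum_y \sum_x \sum_x' w y * w y' * (w x * w x') *
      (B x y * B x y' * (B x' y * B x' y'))).
    rewrite exchange_big; apply: eq_bigr => y' _; apply: eq_bigr => y _.
    rewrite expr2 /codegree mulr_suml mulr_sumr; apply: eq_bigr => x _.
    by rewrite !mulr_sumr; apply: eq_bigr => x' _; ring.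
  rewrite [RHS]exchange_big; apply: eq_bigr => y' _.
  transitivity (\sum_y \sum_x' \sum_x w y * w y' * (w x * w x') *
      (B x y * B x y' * (B x' y * B x' y'))).
    by apply: eq_bigr => y _; rewrite exchange_big.
  rewrite exchange_big; apply: eq_bigr => x' _.
  rewrite exchange_big /= mulr_sumr; apply: eq_bigr => x _.
  by rewrite mulr_sumr; apply: eq_bigr => y _; ring.
rewrite -(sum2_cst pw eps); apply: ler_sum2 => // x' y'.
apply: le_trans (ler_norm _) _.
have := cut (fun x => B x y') (fun y => B x' y * B x' y') _ _; apply.
  by move=> x; apply: B1.
by move=> y; apply: norm_mul_le1.
Qed.

(** Two applications of Cauchy-Schwarz, the first removing [a] and the second [b], give the fourth
    power. *)
Lemma cut_le_box B eps : 0 <= eps -> box B <= eps ^+ 4 -> cut_norm_le w B eps.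
Proof.
case: (pw) => w0 w1 e0 hbox a b a1 b1.
set t := \sum_x _; pose s x := \sum_y w y * (B x y * b y).
have sq1 (x : R) : `|x| <= 1 -> x ^+ 2 <= 1.
  by move=> h; rewrite -real_normK ?num_real // exprn_ile1.
have t2 : t ^+ 2 <= sum2 w (fun y y' => codegree B y y' * b y * b y').
  have -> : t = \sum_x w x * (a x * s x).
    apply: eq_bigr => x _; rewrite /s !mulr_sumr; apply: eq_bigr => y _; ring.
  apply: le_trans (sqr_wsum_le _ pw) _.
  apply: (@le_trans _ _ (\sum_x w x * s x ^+ 2)).
    apply: ler_sum => x _; rewrite ler_wpM2l // exprMn ler_piMl ?sqr_ge0 //.
    exact: sq1.
  have -> // : \sum_x w x * s x ^+ 2 = sum2 w (fun y y' => codegree B y y' * b y * b y').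
  transitivity (\sum_x \sum_y \sum_y' w x * w y * w y' * (B x y * B x y' * b y * b y')).
    apply: eq_bigr => x _; rewrite expr2 /s mulr_suml mulr_sumr; apply: eq_bigr => y _.
    by rewrite !mulr_sumr; apply: eq_bigr => y' _; ring.
  rewrite exchange_big; apply: eq_bigr => y _; rewrite exchange_big; apply: eq_bigr => y' _.
  by rewrite /codegree 2!mulr_suml mulr_sumr; apply: eq_bigr => x _; ring.
have t4 : `|t| ^+ 4 <= eps ^+ 4.
  apply: le_trans hbox; rewrite -[4%N]/(2 * 2)%N exprM real_normK ?num_real //.
  apply: (@le_trans _ _ (sum2 w (fun y y' => codegree B y y' * b y * b y') ^+ 2)).
    by rewrite lerXn2r ?nnegrE ?sqr_ge0 // (le_trans (sqr_ge0 t)).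
  apply: le_trans (sqr_sum2_le pw _) _; apply: ler_sum2 => // y y'.
  rewrite exprMn exprMn -mulrA ler_piMr ?sqr_ge0 //.
  by rewrite mulr_ile1 ?sqr_ge0 ?sq1.
by rewrite -(@ler_pXn2r _ 4) // nnegrE.
Qed.

End Box.

Section Sampling.
Variable R : realFieldType.

Definition unif (U : finType) : U -> R := fun=> #|U|%:R^-1.

(** Extension by zero to all of [V] lets tuples drawn from different sets [X] be averaged on one
    space. *)
Definition setw (V : finType) (X : {set V}) : V -> R := fun x => (x \in X)%:R / #|X|%:R.

Lemma unif_prob (U : finType) : (0 < #|U|)%N -> prob_weight (@unif U).
Proof.
move=> U0; split; first by move=> x; rewrite invr_ge0 ler0n.
by rewrite sumr_const -[_ *+ _]mulr_natr mulVf // pnatr_eq0 -lt0n.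
Qed.

Lemma setw_prob (V : finType) (X : {set V}) : (0 < #|X|)%N -> prob_weight (setw X).
Proof.
move=> X0; split; first by move=> x; rewrite divr_ge0 ?ler0n.
rewrite -mulr_suml (bigID (mem X)) /= [X in _ + X]big1 ?addr0; last first.
  by move=> x /negbTE ->.
rewrite (eq_bigr (fun=> 1)); last by move=> x ->.
by rewrite sumr_const divff // pnatr_eq0 -lt0n.
Qed.

Lemma setw_le (V : finType) (X : {set V}) x : setw X x <= #|X|%:R^-1.
Proof. by rewrite ler_piMl ?invr_ge0 ?ler0n //; case: (x \in X); rewrite ?lexx ?ler01. Qed.

Lemma sum_enum_val n (X : {set 'I_n}) (F : 'I_n -> R) :
  \sum_(i : 'I_#|X|) unif i * F (enum_val i) = \sum_x setw X x * F x.
Proof.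
rewrite /unif card_ord -(big_enum_val (fun x => #|X|%:R^-1 * F x)) /=.
rewrite [RHS](bigID (mem X)) /= [X in _ = _ + X]big1 ?addr0.
  by apply: eq_bigr => x xX; rewrite /setw xX mul1r.
by move=> x /negbTE xX; rewrite /setw xX !mul0r.
Qed.

(** Union bound over pairs of entries: a resampled entry hits a given point with weight at most
    [eps]. *)
Lemma collisions (U : finType) d (w : U -> R) eps :
  prob_weight w -> (forall x, w x <= eps) ->
  \sum_(z : {ffun 'I_d -> U} | ~~ injectiveb z) prodw w z <= (d * d)%:R * eps.
Proof.
move=> pw weps; have p0 := fun z => @prodw_ge0 R U d w z pw.
apply: (@le_trans _ _ (\sum_(z : {ffun 'I_d -> U}) prodw w z *
   \sum_(e : 'I_d * 'I_d | e.1 != e.2) (z e.1 == z e.2)%:R)).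
  rewrite big_mkcond /=; apply: ler_sum => z _; case: ifPn => [ninj|_]; last first.
    by rewrite mulr_ge0 // sumr_ge0 // => e _; rewrite ler0n.
  have /injectivePn[i [j ij zij]] := ninj.
  rewrite ler_peMr // (bigD1 (j, i)) /= 1?eq_sym // zij eqxx.
  by rewrite lerDl sumr_ge0 // => e _; rewrite ler0n.
under eq_bigr do rewrite mulr_sumr.
rewrite exchange_big /=.
apply: (@le_trans _ _ (\sum_(e : 'I_d * 'I_d | e.1 != e.2) eps)); last first.
  have eps0 : (0 < d)%N -> 0 <= eps.
    move=> d0; case: pw => w0 w1; case: (pickP (@predT U)) => [x _|none].
      exact: le_trans (w0 x) (weps x).
    by move: w1; rewrite big_pred0 // => /eqP; rewrite eq_sym oner_eq0.
  case: d {p0} eps0 => [|d] eps0; first by rewrite big1 ?mul0r // => -[[]].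
  rewrite sumr_const -[leLHS]mulr_natl ler_wpM2r ?eps0 // ler_nat.
  by apply: leq_trans (max_card _) _; rewrite card_prod card_ord.
apply: ler_sum => -[i j] /= ij.
rewrite (resample i _ pw).
apply: (@le_trans _ _ (\sum_(z : {ffun 'I_d -> U}) prodw w z * eps)); last first.
  by rewrite -mulr_suml sum_prodw // mul1r.
apply: ler_sum => z _; rewrite ler_wpM2l //.
rewrite (bigD1 (z j)) //= big1 ?addr0.
  by rewrite !ffunE eqxx [j == i]eq_sym (negbTE ij) eqxx /= mulr1.
by move=> u /negbTE uz; rewrite !ffunE eqxx [j == i]eq_sym (negbTE ij) uz /= mulr0.
Qed.

Lemma card_supersets n r (A : {set 'I_n}) : (r <= n)%N ->
  #|[set X : {set 'I_n} | (#|X| == r) && (A \subset X)]| = 'C(n - #|A|, n - r).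
Proof.
move=> rn; have cA : #|~: A| = (n - #|A|)%N by rewrite cardsCs setCK card_ord.
rewrite -cA -cards_draws -(card_imset _ (@setC_inj _)); apply: eq_card => X.
apply/imsetP/idP => [[Y + ->]|].
  rewrite !inE => /andP[/eqP cY sY]; rewrite setCS sY.
  by rewrite cardsCs setCK card_ord cY eqxx.
rewrite !inE => /andP[sX /eqP cX]; exists (~: X); rewrite ?setCK // !inE.
rewrite cardsCs setCK card_ord cX subKn // eqxx /=.
by rewrite -setCS setCK.
Qed.

(** Drawing a random [X] and then [d] independent nodes of [X] is nearly the same as drawing [d]
    independent nodes of the whole set. The error term is the distance of the two laws times the
    bound on [H]. *)
Lemma sampling n r d (H : {ffun 'I_d -> 'I_n} -> R) (c : R) :
  (0 < r)%N -> (r <= n)%N -> (forall z, `|H z| <= c) ->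
  \sum_(X : {set 'I_n} | #|X| == r) \sum_z prodw (setw X) z * H z <=
  'C(n, r)%:R * (\sum_z prodw (@unif 'I_n) z * H z + 4 * c * (d * d)%:R / r%:R).
Proof.
move=> r0 rn Hc.
have n0 : (0 < n)%N := leq_trans r0 rn.
have m0 : 'C(n, r)%:R != 0 :> R by rewrite pnatr_eq0 -lt0n bin_gt0.
have c0 : 0 <= c.
  by apply: le_trans (Hc [ffun=> Ordinal n0]); exact: normr_ge0.
have pu : prob_weight (@unif 'I_n) by apply: unif_prob; rewrite card_ord.
have cm : #|[set X : {set 'I_n} | #|X| == r]| = 'C(n, r).
  by rewrite card_draws card_ord.
pose W (z : {ffun 'I_d -> 'I_n}) : R :=
  'C(n, r)%:R^-1 * \sum_(X : {set 'I_n} | #|X| == r) prodw (setw X) z.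
pose V (z : {ffun 'I_d -> 'I_n}) : R := prodw (@unif 'I_n) z.
have px (X : {set 'I_n}) : #|X| == r -> prob_weight (setw X).
  by move=> /eqP cX; apply: setw_prob; rewrite cX.
have W0 z : 0 <= W z.
  rewrite mulr_ge0 ?invr_ge0 ?ler0n //; apply: sumr_ge0 => X cX.
  by apply: prodw_ge0; apply: px.
have V0 z : 0 <= V z by apply: prodw_ge0.
have avg (g : {set 'I_n} -> R) (k : R) : (forall X : {set 'I_n}, #|X| == r -> g X = k) ->
    'C(n, r)%:R^-1 * \sum_(X : {set 'I_n} | #|X| == r) g X = k.
  move=> gk; rewrite (eq_bigr (fun=> k)) //.
  by rewrite sumr_const -cardsE cm -[k *+ _]mulr_natl mulKf.
have sW : \sum_z W z = 1.
  rewrite -mulr_sumr exchange_big /=; apply: avg => X cX.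
  by rewrite sum_prodw //; apply: px.
have sV : \sum_z V z = 1 by apply: sum_prodw.
have cW : \sum_(z : {ffun 'I_d -> 'I_n} | ~~ injectiveb z) W z <= (d * d)%:R / r%:R.
  rewrite -mulr_sumr exchange_big /=.
  rewrite -[leRHS](avg (fun=> (d * d)%:R / r%:R)) //.
  rewrite ler_wpM2l ?invr_ge0 ?ler0n //; apply: ler_sum => X cX.
  apply: collisions; first exact: px.
  by move=> x; rewrite -(eqP cX) setw_le.
have cV : \sum_(z : {ffun 'I_d -> 'I_n} | ~~ injectiveb z) V z <= (d * d)%:R / r%:R.
  apply: collisions => // x; rewrite /unif card_ord lef_pV2 ?posrE ?ltr0n //.
  by rewrite ler_nat.
pose k : R := 'C(n, r)%:R^-1 * (r%:R^-1 ^+ d * 'C(n - d, n - r)%:R) - n%:R^-1 ^+ d.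
(* [W] is constant on injective tuples, so [W] and [V] differ only through
   collisions. *)
have DE (z : {ffun 'I_d -> 'I_n}) : injectiveb z -> W z - V z = k.
  move=> /injectiveP zi; rewrite /W /V /k; congr (_ * _ - _); last first.
    rewrite /prodw (eq_bigr (fun=> n%:R^-1)); last by move=> i _; rewrite /unif card_ord.
    by rewrite prodr_const card_ord.
  have -> : (n - d)%N = (n - #|z @: setT|)%N by rewrite card_imset // cardsT card_ord.
  rewrite -card_supersets // -sum1_card natr_sum mulr_sumr.
  rewrite big_mkcond [RHS]big_mkcond /=; apply: eq_bigr => X _; rewrite inE.
  case: eqP => //= cX; rewrite /prodw big_split /= prodr_const card_ord cX mulrC.
  case: ifPn => [/subsetP sX|nsX].
    by rewrite big1 // => i _; rewrite sX // imset_f.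
  have /existsP[i zX] : [exists i, z i \notin X].
    apply: contraR nsX; rewrite negb_exists => /forallP hz.
    by apply/subsetP => x /imsetP[i _ ->]; have := hz i; rewrite negbK.
  by rewrite (bigD1 i) //= (negbTE zX) mul0r mulr0.
(* Collisions contribute at most [2 * d ^ 2 / r]. On injective tuples the difference has constant
   sign, so its mass is the absolute value of its total, which cancels the total over collisions:
   another [2 * d ^ 2 / r]. *)
have tv : \sum_z `|W z - V z| <= 4 * ((d * d)%:R / r%:R).
  rewrite (bigID (fun z : {ffun 'I_d -> 'I_n} => injectiveb z)) /=.
  have n1 : \sum_(z : {ffun 'I_d -> 'I_n} | ~~ injectiveb z) `|W z - V z| <= 2 * ((d * d)%:R / r%:R).
    apply: (@le_trans _ _ (\sum_(z : {ffun 'I_d -> 'I_n} | ~~ injectiveb z) (W z + V z))).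
      by apply: ler_sum => z _; rewrite (le_trans (ler_normB _ _)) // !ger0_norm.
    by rewrite big_split /=; lra.
  have n2 : \sum_(z : {ffun 'I_d -> 'I_n} | injectiveb z) `|W z - V z| = `|\sum_(z : {ffun 'I_d -> 'I_n} | injectiveb z) (W z - V z)|.
    rewrite (eq_bigr (fun=> `|k|)); last by move=> z zi; rewrite DE.
    rewrite [in RHS](eq_bigr (fun=> k)); last by move=> z zi; rewrite DE.
    by rewrite !sumr_const normrMn.
  have n3 : \sum_(z : {ffun 'I_d -> 'I_n} | injectiveb z) (W z - V z) = - \sum_(z : {ffun 'I_d -> 'I_n} | ~~ injectiveb z) (W z - V z).
    have : \sum_z (W z - V z) = 0 by rewrite sumrB sW sV subrr.
    rewrite (bigID (fun z : {ffun 'I_d -> 'I_n} => injectiveb z)) /= => /eqP.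
    by rewrite addr_eq0 => /eqP.
  rewrite n2 n3 normrN.
  have n4 : `|\sum_(z : {ffun 'I_d -> 'I_n} | ~~ injectiveb z) (W z - V z)| <=
      \sum_(z : {ffun 'I_d -> 'I_n} | ~~ injectiveb z) `|W z - V z|.
    exact: ler_norm_sum.
  lra.
have -> : \sum_(X : {set 'I_n} | #|X| == r) \sum_z prodw (setw X) z * H z =
  'C(n, r)%:R * \sum_z W z * H z.
  rewrite exchange_big mulr_sumr; apply: eq_bigr => z _ /=.
  by rewrite -mulr_suml mulrA mulVKf.
rewrite ler_wpM2l ?ler0n // -lerBlDl -sumrB.
apply: le_trans (_ : \sum_z `|W z - V z| * c <= _).
  apply: ler_sum => z _; rewrite -mulrBl; apply: le_trans (ler_norm _) _.
  by rewrite normrM ler_wpM2l.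
rewrite -mulr_suml; have := ler_wpM2r c0 tv; lra.
Qed.

End Sampling.

(** Markov's inequality for the statistic of [X] given by the mean of [H] over tuples from [X]. *)
Lemma sampling_prob (R : realType) n r d (H : {ffun 'I_d -> 'I_n} -> R) (c t delta : R)
    (P : {set 'I_n} -> bool) :
  (0 < r)%N -> (r <= n)%N -> (forall z, `|H z| <= c) -> 0 < t ->
  (forall X : {set 'I_n}, #|X| = r -> 0 <= \sum_z prodw (@setw R _ X) z * H z) ->
  (forall X : {set 'I_n}, #|X| = r -> P X -> t <= \sum_z prodw (@setw R _ X) z * H z) ->
  \sum_z prodw (@unif R 'I_n) z * H z + 4 * c * (d * d)%:R / r%:R < t * delta ->
  @prob_rsubset R n r P < delta.
Proof.
move=> r0 rn Hc t0 st0 stP lt.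
have m0 : 0 < 'C(n, r)%:R :> R by rewrite ltr0n bin_gt0.
rewrite /prob_rsubset ltr_pdivrMr // -(ltr_pM2l t0) mulrA.
apply: (@le_lt_trans _ _ (\sum_(X : {set 'I_n} | #|X| == r) \sum_z prodw (@setw R _ X) z * H z)).
  rewrite -sum1_card natr_sum mulr_sumr big_mkcond [leRHS]big_mkcond /=.
  apply: ler_sum => X _; rewrite inE; case: eqP => //= cX.
  by case: ifP => [PX|_]; [rewrite mulr1 stP | rewrite st0].
apply: le_lt_trans (sampling r0 rn Hc) _.
by rewrite mulrC ltr_pM2r.
Qed.

(** * Samples of colored digraphs *)

Section Tests.
Variables (R : realType) (k : nat).

Definition pull n q (L : cdigraph k n) (y : {ffun 'I_q -> 'I_n}) : cdigraph k q :=
  [ffun p : 'I_q * 'I_q => L (y p.1, y p.2)].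

Lemma push_enum_val n q (X : {set 'I_n}) (Phi : {ffun 'I_q -> 'I_n} -> R) :
  \sum_(z : {ffun 'I_q -> 'I_#|X|}) prodw (@unif R _) z * Phi [ffun i => enum_val (z i)] =
  \sum_z prodw (@setw R _ X) z * Phi z.
Proof.
rewrite push_tuple; apply: eq_bigr => z _; congr (_ * _); apply: eq_bigr => i _.
transitivity (\sum_(j : 'I_#|X|) unif R j * (enum_val j == z i)%:R).
  rewrite /pushw big_mkcond; apply: eq_bigr => j _.
  by case: eqP; rewrite ?mulr1 ?mulr0.
rewrite (sum_enum_val X (fun x => (x == z i)%:R : R)) (bigD1 (z i)) //= eqxx mulr1.
by rewrite big1 ?addr0 // => x /negbTE ->; rewrite mulr0.
Qed.

Lemma nat_gt (x : R) : exists n : nat, (0 < n)%N /\ x < n%:R.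
Proof.
exists (Num.bound `|x|).+1; split=> //.
apply: le_lt_trans (ler_norm _) _; apply: lt_trans (archi_boundP (normr_ge0 _)) _.
by rewrite ltr_nat.
Qed.

Variable g : forall n, cdigraph k n -> R.

(** Sizes such as [#|X|] and [q] are equal without being convertible; once they are identified, the
    injection becomes a permutation. *)
Lemma cdg_cast_iso n n' (L : cdigraph k n) (L' : cdigraph k n') (e : 'I_n -> 'I_n') :
  cdg_param g -> n = n' -> injective e ->
  (forall u v, u != v -> L' (e u, e v) = L (u, v)) -> g L' = g L.
Proof.
move=> [_ inv] nn'; subst n' => ei h.
by apply: (inv n (perm ei)) => u v uv; rewrite !permE h.
Qed.

Lemma pull_induced n q (L : cdigraph k n) (y : {ffun 'I_q -> 'I_n}) (X : {set 'I_n}) :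
  cdg_param g -> injective y -> (forall i, y i \in X) -> #|X| = q ->
  g (induced_cdg L X) = g (pull L y).
Proof.
move=> pg yi yX cX; apply: (@cdg_cast_iso _ _ _ _ (fun i => enum_rank_in (yX i) (y i))) => //.
  move=> i j /(congr1 enum_val); rewrite !enum_rankK_in //; exact: yi.
by move=> u v _; rewrite !ffunE /= !enum_rankK_in.
Qed.

(** Repeated entries count as failure, so the test is defined on all tuples and its mean is a tuple
    average. *)
Definition bad_sample (eps : R) n q (L : cdigraph k n) (y : {ffun 'I_q -> 'I_n}) : bool :=
  ~~ (injectiveb y && (`|g L - g (pull L y)| <= eps)).

Lemma ffact_le_exp n q : (n ^_ q <= n ^ q)%N.
Proof.
rewrite -{1}(card_ord n) -{1}(card_ord q) -card_inj_ffuns.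
by apply: leq_trans (max_card _) _; rewrite card_ffun !card_ord.
Qed.

Lemma sum_injective_image n q (X : {set 'I_n}) :
  \sum_(y : {ffun 'I_q -> 'I_n} | injectiveb y && (y @: setT == X)) prodw (@unif R _) y
  <= (q`!)%:R * n%:R^-1 ^+ q.
Proof.
rewrite (eq_bigr (fun=> n%:R^-1 ^+ q)); last first.
  by move=> y _; rewrite /prodw /unif prodr_const !card_ord.
rewrite sumr_const -[leLHS]mulr_natl ler_wpM2r ?exprn_ge0 ?invr_ge0 ?ler0n // ler_nat.
case: (pickP (fun y : {ffun 'I_q -> 'I_n} => injectiveb y && (y @: setT == X))) => [y|none].
  move=> /andP[/injectiveP yi /eqP yX].
  have cX : #|X| = q by rewrite -yX card_imset // cardsT card_ord.
  have -> : q`! = #|[set f : {ffun 'I_q -> 'I_n} in ffun_on (mem X) | injectiveb f]|.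
    by rewrite card_inj_ffuns_on card_ord cX ffactnn.
  apply: subset_leq_card; apply/subsetP => f.
  rewrite !inE => /andP[fi /eqP fX]; rewrite fi andbT.
  by apply/ffun_onP => i; rewrite -fX imset_f.
by rewrite eq_card0 // => y; rewrite unfold_in none.
Qed.

Lemma tuple_test (eps delta : R) : cdg_estimable g -> 0 < eps -> 0 < delta ->
  exists q n0 : nat, (0 < n0)%N /\ forall n (L : cdigraph k n), (n0 <= n)%N ->
  \sum_(y : {ffun 'I_q -> 'I_n}) prodw (@unif R _) y * (bad_sample eps L y)%:R < delta.
Proof.
move=> [pg est] e0 d0; have d2 : 0 < delta / 2 by rewrite divr_gt0.
have [q [q0 hq]] := est _ _ e0 d2.
have [N [N0 hN]] := nat_gt ((q * q)%:R / (delta / 2)).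
exists q, (maxn q N); split; first by rewrite leq_max q0.
move=> n L; rewrite geq_max => /andP[qn Nn].
have n0 : (0 < n)%N := leq_trans N0 Nn.
have pu : prob_weight (@unif R 'I_n) by apply: unif_prob; rewrite card_ord.
have := hq n L qn; set bad := fun X : {set 'I_n} => _ => hbad.
have coll : \sum_(y : {ffun 'I_q -> 'I_n} | ~~ injectiveb y) prodw (@unif R _) y < delta / 2.
  apply: (@le_lt_trans _ _ ((q * q)%:R * n%:R^-1)).
    by apply: collisions => // x; rewrite /unif card_ord.
  rewrite ltr_pdivrMr ?ltr0n // mulrC -ltr_pdivrMr //.
  by apply: lt_le_trans hN _; rewrite ler_nat.
pose goodinj (y : {ffun 'I_q -> 'I_n}) := injectiveb y && bad (y @: setT).
(* Tuples are grouped by image. A set of [q] nodes is the image of at most [q!] injective tuples,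
   and ['C(n, q) * q! <= n ^ q]. *)
have main : \sum_(y | goodinj y) prodw (@unif R _) y < delta / 2.
  rewrite (partition_big (fun y : {ffun 'I_q -> 'I_n} => y @: setT)
    (fun X => (#|X| == q) && bad X)) /=; last first.
    by move=> y /andP[/injectiveP yi ->]; rewrite card_imset // cardsT card_ord eqxx.
  apply: (@le_lt_trans _ _ (\sum_(X : {set 'I_n} | (#|X| == q) && bad X)
      (q`!)%:R * n%:R^-1 ^+ q)).
    apply: ler_sum => X /andP[_ bX]; apply: le_trans (sum_injective_image q X).
    rewrite big_mkcond [leRHS]big_mkcond /=; apply: ler_sum => y _.
    rewrite /goodinj; case: ifP => [/andP[/andP[-> _] ->] //|_].
    by case: ifP => // _; apply: prodw_ge0.
  rewrite sumr_const -[ltLHS]mulr_natl.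
  move: hbad; rewrite /prob_rsubset ltr_pdivrMr ?ltr0n ?bin_gt0 // cardsE => hbad.
  apply: (@lt_le_trans _ _ (delta / 2 * ('C(n, q) * q`!)%:R * n%:R^-1 ^+ q)).
    have -> : delta / 2 * ('C(n, q) * q`!)%:R * n%:R^-1 ^+ q =
      (delta / 2 * 'C(n, q)%:R) * ((q`!)%:R * n%:R^-1 ^+ q) by rewrite natrM !mulrA.
    rewrite ltr_pM2r //.
    by rewrite mulr_gt0 ?ltr0n ?fact_gt0 // exprn_gt0 // invr_gt0 ltr0n.
  rewrite -mulrA; apply: ler_piMr; first exact: ltW.
  rewrite exprVn ler_pdivrMr ?exprn_gt0 ?ltr0n // mul1r.
  by rewrite bin_ffact -natrX ler_nat ffact_le_exp.
apply: (@le_lt_trans _ _ (\sum_(y | goodinj y) prodw (@unif R _) y +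
    \sum_(y : {ffun 'I_q -> 'I_n} | ~~ injectiveb y) prodw (@unif R _) y)); last by lra.
rewrite [X in _ <= X + _]big_mkcond [X in _ <= _ + X]big_mkcond -big_split /=.
apply: ler_sum => y _; have p0 := prodw_ge0 y pu.
rewrite /bad_sample /goodinj /bad; case: (boolP (injectiveb y)) => [yi|_] /=; last first.
  by rewrite add0r mulr1.
have -> : g (induced_cdg L (y @: setT)) = g (pull L y).
  move/injectiveP: yi => yi.
  apply: pull_induced => //; first by move=> i; rewrite imset_f.
  by rewrite card_imset // cardsT card_ord.
by rewrite -ltNge addr0; case: ifP; rewrite ?mulr1 ?mulr0.
Qed.

(* Estimability only provides one sample size; this yields all large ones. *)
Lemma induced_test (eps delta : R) : cdg_estimable g -> 0 < eps -> 0 < delta ->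
  exists r0 : nat, forall r n (L : cdigraph k n), (r0 <= r)%N -> (r <= n)%N ->
  @prob_rsubset R n r (fun X => eps < `|g L - g (induced_cdg L X)|) < delta.
Proof.
move=> est e0 d0; have e2 : 0 < eps / 2 by rewrite divr_gt0.
(* The bound 1/4 yields the Markov threshold 3/4; the test on [L] and the sampling error cost [d']
   each, and [2 * d' <= delta / 2] is below [3 / 4 * delta]. *)
pose d' := Order.min (1 / 4) (delta / 4).
have d'0 : 0 < d' by rewrite lt_min !divr_gt0.
have [q [n0 [n00 hq]]] := tuple_test est e2 d'0.
have [N [N0 hN]] := nat_gt (4 * (q * q)%:R / d').
exists (maxn n0 N) => r n L; rewrite geq_max => /andP[n0r Nr] rn.
have r0 : (0 < r)%N := leq_trans N0 Nr.
pose H (y : {ffun 'I_q -> 'I_n}) : R := (bad_sample (eps / 2) L y)%:R.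
apply: (@sampling_prob R n r q H 1 (3 / 4)) => //.
- by move=> z; rewrite /H normr_nat; case: bad_sample; rewrite ?ler01 ?lexx.
- by rewrite divr_gt0.
- move=> X cX; have pX : prob_weight (@setw R _ X) by apply: setw_prob; rewrite cX.
  by apply: sumr_ge0 => z _; rewrite mulr_ge0 ?prodw_ge0 ?ler0n.
- move=> X cX hX; pose M := induced_cdg L X.
  have pX : prob_weight (@setw R _ X) by apply: setw_prob; rewrite cX.
  have pu : prob_weight (@unif R 'I_#|X|) by apply: unif_prob; rewrite card_ord cX.
  have hM := hq #|X| M; rewrite {1}cX in hM; have {}hM := hM n0r.
  rewrite -push_enum_val.
  (* A tuple from [X] induces the same sample in [L] and in [M]. As [g L] and [g M] differ by more
     than [eps], the sample cannot be within [eps / 2] of both, so each tuple is bad for one of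
     them. *)
  have : 1 <= \sum_(z : {ffun 'I_q -> 'I_#|X|}) prodw (@unif R _) z * H [ffun i => enum_val (z i)]
     + \sum_(z : {ffun 'I_q -> 'I_#|X|}) prodw (@unif R _) z * (bad_sample (eps / 2) M z)%:R.
    rewrite -{1}(sum_prodw q pu) -big_split /=; apply: ler_sum => z _.
    rewrite -mulrDr ler_peMr ?prodw_ge0 // -natrD ler1n.
    rewrite addn_gt0 !lt0b /bad_sample; apply/negPn/negP.
    rewrite negb_or !negbK => /andP[/andP[_ h1] /andP[_ h2]].
    have pe : pull L [ffun i => enum_val (z i)] = pull M z.
      by apply/ffunP => p; rewrite !ffunE.
    move: h1 h2 hX; rewrite pe => h1 h2; rewrite ltNge => /negP; apply.
    rewrite -(subrKA (g (pull M z))); apply: le_trans (ler_normD _ _) _.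
    by rewrite [X in _ + X]distrC; lra.
  have : d' <= 1 / 4 by rewrite ge_min lexx.
  lra.
have h1 := hq n L (leq_trans n0r rn).
have h2 : 4 * 1 * (q * q)%:R / r%:R < d'.
  rewrite mulr1 ltr_pdivrMr ?ltr0n // [d' * _]mulrC -ltr_pdivrMr //.
  by apply: lt_le_trans hN _; rewrite ler_nat.
have : d' <= delta / 4 by rewrite ge_min lexx orbT.
rewrite -/(H _) in h1 *.
lra.
Qed.

End Tests.

(** * Cut norms of labelled kernels, and the box norm as a tuple average *)

Section Statistics.
Variable R : realFieldType.

(** For each of the [#|Lb| ^ 2] pairs of labels, [p] is a constant and the label indicators are
    absorbed by the tests. *)
Lemma cut_norm_le_labels (U Lb : finType) (w : U -> R) (lab : U -> Lb) (D : U -> U -> R)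
    (p : Lb -> Lb -> R) eps :
  cut_norm_le w D eps -> (forall i j, `|p i j| <= 1) ->
  cut_norm_le w (fun x y => D x y * p (lab x) (lab y)) ((#|Lb| * #|Lb|)%:R * eps).
Proof.
move=> cut p1 a b a1 b1; have e0 := cut_norm_le_ge0 cut.
pose al i x := (lab x == i)%:R * a x; pose bl j y := (lab y == j)%:R * b y.
have ind (c : U -> R) i : (forall x, `|c x| <= 1) -> forall x, `|(lab x == i)%:R * c x| <= 1.
  by move=> c1 x; case: eqP; rewrite ?mul1r ?mul0r ?normr0 ?ler01.
have -> : \sum_x \sum_y w x * w y * (D x y * p (lab x) (lab y) * a x * b y) =
  \sum_i \sum_j p i j * \sum_x \sum_y w x * w y * (D x y * al i x * bl j y).
  transitivity (\sum_x \sum_y \sum_i \sum_j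
     p i j * (w x * w y * (D x y * al i x * bl j y))).
    apply: eq_bigr => x _; apply: eq_bigr => y _.
    rewrite (bigD1 (lab x)) //= (bigD1 (lab y)) //= /al /bl !eqxx.
    rewrite [X in _ + X + _]big1; last by move=> j /negbTE; rewrite eq_sym => -> /=; ring.
    rewrite [X in _ + _ + X]big1; last first.
      by move=> i /negbTE; rewrite eq_sym => ->; rewrite big1 // => j _ /=; ring.
    by rewrite /=; ring.
  under eq_bigr do rewrite exchange_big /=.
  rewrite exchange_big; apply: eq_bigr => i _ /=.
  under eq_bigr do rewrite exchange_big /=.
  rewrite exchange_big; apply: eq_bigr => j _ /=.
  by rewrite mulr_sumr; apply: eq_bigr => x _; rewrite mulr_sumr.
apply: le_trans (ler_norm_sum _ _ _) _.
apply: (@le_trans _ _ (\sum_(i : Lb) \sum_(j : Lb) eps)).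
  apply: ler_sum => i _; apply: le_trans (ler_norm_sum _ _ _) _; apply: ler_sum => j _.
  rewrite normrM; apply: le_trans (ler_piMl (normr_ge0 _) (p1 i j)) _.
  by apply: cut; apply: ind.
by rewrite !sumr_const -mulrnA mulr_natl.
Qed.

(** Averaging a test over the random label of a node leaves a test on nodes. *)
Lemma cut_norm_le_marginal (V Lb : finType) (nu : V -> R) (kappa : V -> Lb -> R)
    (D : V -> V -> R) eps :
  cut_norm_le nu D eps -> (forall v l, 0 <= kappa v l) -> (forall v, \sum_l kappa v l = 1) ->
  cut_norm_le (fun t : V * Lb => nu t.1 * kappa t.1 t.2) (fun t t' => D t.1 t'.1) eps.
Proof.
move=> cut k0 k1 a b a1 b1.
have avg (c : V * Lb -> R) v : (forall t, `|c t| <= 1) -> `|\sum_l kappa v l * c (v, l)| <= 1.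
  by move=> c1; apply: norm_wsum; rewrite ?k1.
have := cut (fun v => \sum_l kappa v l * a (v, l)) (fun v => \sum_l kappa v l * b (v, l)).
move=> /(_ (fun v => avg a v a1) (fun v => avg b v b1)); congr (`|_| <= _).
rewrite [RHS](eq_bigr (fun t : V * Lb => \sum_v' \sum_l' nu t.1 * kappa t.1 t.2 *
  (nu v' * kappa v' l') * (D t.1 v' * a (t.1, t.2) * b (v', l')))); last first.
  by case=> v l _; rewrite pair_bigA; apply: eq_bigr => -[].
rewrite -(pair_bigA _ (fun v l => \sum_v' \sum_l' nu v * kappa v l *
  (nu v' * kappa v' l') * (D v v' * a (v, l) * b (v', l')))) /=.
apply: eq_bigr => v _; rewrite exchange_big; apply: eq_bigr => v' _ /=.
transitivity ((\sum_l kappa v l * a (v, l)) * ((\sum_l kappa v' l * b (v', l)) *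
  (nu v * nu v' * D v v'))); first by ring.
rewrite mulr_suml; apply: eq_bigr => l _.
by rewrite mulr_suml mulr_sumr; apply: eq_bigr => l' _; ring.
Qed.

Definition o40 : 'I_4 := @Ordinal 4 0 isT.
Definition o41 : 'I_4 := @Ordinal 4 1 isT.
Definition o42 : 'I_4 := @Ordinal 4 2 isT.
Definition o43 : 'I_4 := @Ordinal 4 3 isT.

Lemma sum_prodw2 (U : finType) (w : U -> R) (Phi : U -> U -> R) : prob_weight w ->
  \sum_(z : {ffun 'I_2 -> U}) prodw w z * Phi (z ord0) (z ord_max) = sum2 w Phi.
Proof.
move=> pw; rewrite (resample ord0 _ pw) (resample ord_max _ pw).
rewrite -[RHS]mul1r -(sum_prodw 2 pw) mulr_suml; apply: eq_bigr => z _; congr (_ * _).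
rewrite /sum2 exchange_big /=; apply: eq_bigr => y _; rewrite mulr_sumr.
by apply: eq_bigr => x _; rewrite !ffunE /= mulrA [w x * _]mulrC.
Qed.

Definition box_kernel (U : finType) (B : U -> U -> R) (z : {ffun 'I_4 -> U}) : R :=
  B (z o40) (z o42) * B (z o40) (z o43) * (B (z o41) (z o42) * B (z o41) (z o43)).

Lemma sum_box_kernel (U : finType) (w : U -> R) (B : U -> U -> R) : prob_weight w ->
  \sum_z prodw w z * box_kernel B z = box w B.
Proof.
move=> pw; rewrite (resample o40 _ pw) (resample o41 _ pw) (resample o42 _ pw).
rewrite (resample o43 _ pw) /box_kernel.
rewrite -[RHS]mul1r -(sum_prodw 4 pw) mulr_suml; apply: eq_bigr => z _; congr (_ * _).
rewrite /box /sum2 exchange_big /=; apply: eq_bigr => y' _; rewrite mulr_sumr.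
apply: eq_bigr => y _; rewrite expr2 /codegree mulr_suml !mulr_sumr.
apply: eq_bigr => x' _; rewrite !mulr_sumr.
by apply: eq_bigr => x _; rewrite !ffunE /=; ring.
Qed.

Lemma box_kernel_norm (U : finType) (B : U -> U -> R) z :
  (forall x y, `|B x y| <= 1) -> `|box_kernel B z| <= 1.
Proof. by move=> B1; do ?apply: norm_mul_le1. Qed.

Lemma box_enum_val n (X : {set 'I_n}) (B : 'I_n -> 'I_n -> R) :
  box (@unif R 'I_#|X|) (fun i j => B (enum_val i) (enum_val j)) = box (@setw R _ X) B.
Proof.
rewrite /box /sum2.
transitivity (\sum_(i : 'I_#|X|) unif R i * \sum_(j : 'I_#|X|) unif R j *
    codegree (@setw R _ X) B (enum_val i) (enum_val j) ^+ 2).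
  apply: eq_bigr => i _; rewrite mulr_sumr; apply: eq_bigr => j _; rewrite mulrA.
  congr (_ * _ ^+ 2).
  exact: (sum_enum_val X (fun x => B x (enum_val i) * B x (enum_val j))).
rewrite (sum_enum_val X (fun x => \sum_(j : 'I_#|X|) unif R j *
    codegree (@setw R _ X) B x (enum_val j) ^+ 2)).
apply: eq_bigr => x _.
rewrite (sum_enum_val X (fun y => codegree (@setw R _ X) B x y ^+ 2)) mulr_sumr.
by apply: eq_bigr => y _; rewrite mulrA.
Qed.

End Statistics.

Lemma injectivePn_lt q (T : eqType) (z : 'I_q -> T) :
  ~~ injectiveb z -> exists i j : 'I_q, (i < j)%N /\ z i = z j.
Proof.
move=> /injectivePn[i [j ij zij]].
case: (ltngtP i j) => [lt|lt|/val_inj e]; first by exists i, j.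
  by exists j, i.
by rewrite e eqxx in ij.
Qed.

(** * Random lifts of a graph *)

Section Patterns.
Variables (R : realType) (k m : nat).

(** Adjacency in the shadow depends on both orientations of a pair, so their two colors are treated
    and drawn jointly. *)
Notation color := ('I_k * 'I_k)%type.

Definition swap (c : color) : color := (c.2, c.1).

Lemma swapK : involutive swap.
Proof. by case. Qed.

Definition linked (c : color) : bool := (c.1 < m)%N || (c.2 < m)%N.

Lemma linked_swap c : linked (swap c) = linked c.
Proof. by rewrite /linked orbC. Qed.

(* Diagonal pairs are excluded from [adj] and [col], so that a product over all
   pairs of entries of a tuple vanishes when the tuple is not injective. *)
Definition adj (U : finType) (G : rel U) (a : bool) x y : R :=
  ((x != y) && (G x y == a))%:R.

Definition col n (L : cdigraph k n) (c : color) x y : R :=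
  ((x != y) && ((L (x, y), L (y, x)) == c))%:R.

Definition sameoff q (L F : cdigraph k q) : bool :=
  [forall i, forall j, (i != j) ==> (L (i, j) == F (i, j))].

(* Diagonal entries of colored digraphs are junk; [normal] overwrites them, which
   turns isomorphism over the identity into equality. *)
Definition normal (c0 : 'I_k) q (L : cdigraph k q) : cdigraph k q :=
  [ffun p => if p.1 == p.2 then c0 else L p].

Definition pair_colors q (F : cdigraph k q) (e : 'I_q * 'I_q) : color := (F e, F (e.2, e.1)).

Lemma prod_col n q (L : cdigraph k n) (F : cdigraph k q) (z : {ffun 'I_q -> 'I_n}) :
  \prod_(e : 'I_q * 'I_q | (e.1 < e.2)%N) col L (pair_colors F e) (z e.1) (z e.2) =
  (injectiveb z && sameoff (pull L z) F)%:R.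
Proof.
case: (boolP (injectiveb z)) => [/injectiveP zi|/injectivePn_lt[i [j [lt zij]]]] /=; last first.
  by rewrite (bigD1 (i, j)) //= /col zij eqxx mul0r.
case: (boolP (sameoff _ _)) => [/forallP so|] /=.
  have {}so i j : i != j -> L (z i, z j) = F (i, j).
    by move=> ij; have /forallP/(_ j)/implyP/(_ ij)/eqP := so i; rewrite ffunE.
  apply: big1 => -[i j] /= ij; have nij : i != j by rewrite neq_ltn ij.
  by rewrite /col /pair_colors /= (inj_eq zi) nij !so // 1?eq_sym // eqxx.
rewrite negb_forall => /existsP[i]; rewrite negb_forall => /existsP[j].
rewrite negb_imply ffunE /= => /andP[ij ne].
case: (ltngtP i j) => [lt|lt|/val_inj e]; last by rewrite e eqxx in ij.
  by rewrite (bigD1 (i, j)) //= /col /pair_colors /= xpair_eqE (negbTE ne) andbF mul0r.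
by rewrite (bigD1 (j, i)) //= /col /pair_colors /= xpair_eqE (negbTE ne) !andbF mul0r.
Qed.

(** Turns the frequency of a family of samples into a sum of edge products, the form required by
    [counting]. Only normal [F] are summed, since otherwise each sample would be counted once per
    diagonal. *)
Lemma sum_patterns c0 n q (L : cdigraph k n) (Fs : pred (cdigraph k q))
    (z : {ffun 'I_q -> 'I_n}) :
  \sum_(F : cdigraph k q | Fs F && (normal c0 F == F))
    \prod_(e : 'I_q * 'I_q | (e.1 < e.2)%N) col L (pair_colors F e) (z e.1) (z e.2) =
  (injectiveb z && Fs (normal c0 (pull L z)))%:R.
Proof.
under eq_bigr do rewrite prod_col.
case: (injectiveb z); last by rewrite big1.
set N := normal c0 (pull L z) => /=.
have soE (F : cdigraph k q) : normal c0 F == F -> sameoff (pull L z) F = (N == F).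
  move=> /eqP nF; apply/forallP/eqP => [so|<- i].
    apply/ffunP => -[i j]; rewrite -nF /N !ffunE /=; case: eqP => // /eqP ij.
    by have /forallP/(_ j)/implyP/(_ ij)/eqP := so i; rewrite ffunE.
  by apply/forallP => j; apply/implyP => ij; rewrite /N !ffunE /= (negbTE ij).
have NN : normal c0 N == N.
  by apply/eqP/ffunP => -[i j]; rewrite /N !ffunE /=; case: (eqVneq i j).
transitivity (\sum_(F : cdigraph k q | Fs F && (normal c0 F == F)) (N == F)%:R : R).
  by apply: eq_bigr => F /andP[_ nF]; rewrite soE.
case: (boolP (Fs N)) => FN.
  rewrite (bigD1 N) ?FN ?NN //= eqxx big1 ?addr0 // => F /andP[_].
  by rewrite eq_sym => /negbTE ->.
rewrite big1 // => F /andP[FF _]; case: eqP => // e.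
by rewrite e FF in FN.
Qed.

Section RandomLift.
Variables (n : nat) (G : rel 'I_n) (Lb : finType) (p : color -> Lb -> Lb -> R) (c0 : 'I_k).
Hypothesis Gsym : forall u v, G u v = G v u.
Hypothesis p0 : forall c i j, 0 <= p c i j.
Hypothesis psym : forall c i j, p (swap c) j i = p c i j.
(** Asked only for adjacency values that occur in [G]: for [k = m] no color pair is unlinked, and
    the sum over unlinked ones is empty. *)
Hypothesis psum : forall u v, u != v -> forall i j, \sum_(c | linked c == G u v) p c i j = 1.

(* Only the entries of [lam] above the diagonal are used. *)
Definition lift_cdg (lam : {ffun 'I_n * 'I_n -> color}) : cdigraph k n :=
  [ffun e : 'I_n * 'I_n => if (e.1 < e.2)%N then (lam e).1 else (lam (e.2, e.1)).2].

(** A point mass on and below the diagonal makes the product over all ordered pairs a probability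
    weight. *)
Definition pairw (Q : {ffun 'I_n -> Lb}) (e : 'I_n * 'I_n) (c : color) : R :=
  if (e.1 < e.2)%N then (linked c == G e.1 e.2)%:R * p c (Q e.1) (Q e.2)
  else (c == (c0, c0))%:R.

Lemma pairw_sum Q e : \sum_c pairw Q e c = 1.
Proof.
rewrite /pairw; case: (ltnP e.1 e.2) => lt.
  have ne : e.1 != e.2 by rewrite neq_ltn lt.
  apply: eq_trans (psum ne (Q e.1) (Q e.2)); rewrite [RHS]big_mkcond.
  by apply: eq_bigr => c _; case: eqP; rewrite ?mul1r ?mul0r.
by rewrite (bigD1 (c0, c0)) //= eqxx big1 ?addr0 // => c /negbTE ->.
Qed.

Lemma pairw_ge0 Q e c : 0 <= pairw Q e c.
Proof. by rewrite /pairw; case: ifP => _; rewrite ?mulr_ge0 ?ler0n. Qed.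

Lemma lift_shadow Q (lam : {ffun 'I_n * 'I_n -> color}) :
  (forall u, G u u = false) ->
  0 < \prod_e pairw Q e (lam e) -> is_shadow_of m (lift_cdg lam) G.
Proof.
move=> Girr pos.
have key (u v : 'I_n) : (u < v)%N -> linked (lam (u, v)) = G u v.
  move=> lt; apply/eqP; apply: contraTT pos => ne.
  by rewrite (bigD1 (u, v)) //= {1}/pairw lt (negbTE ne) !mul0r ltxx.
apply/forallP => u; apply/forallP => v; apply/eqP; rewrite /shadow !ffunE /=.
case: (ltngtP u v) => [lt|lt|/val_inj ->]; last by rewrite eqxx Girr.
  by rewrite -key // neq_ltn lt.
by rewrite Gsym -key // neq_ltn lt orbT /= orbC.
Qed.

(** For injective [y] the colors involved are independent; for other [y] both sides vanish, through
    [col] and [adj] on the diagonal. *)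
Lemma expect_lift Q q (c : 'I_q * 'I_q -> color) (y : {ffun 'I_q -> 'I_n}) :
  \sum_(lam : {ffun 'I_n * 'I_n -> color}) (\prod_e pairw Q e (lam e)) *
    \prod_(e : 'I_q * 'I_q | (e.1 < e.2)%N) col (lift_cdg lam) (c e) (y e.1) (y e.2) =
  \prod_(e : 'I_q * 'I_q | (e.1 < e.2)%N)
    (adj G (linked (c e)) (y e.1) (y e.2) * p (c e) (Q (y e.1)) (Q (y e.2))).
Proof.
case: (boolP (injectiveb y)) => [/injectiveP yi|/injectivePn_lt[i [j [lt yij]]]]; last first.
  rewrite [RHS](bigD1 (i, j)) //= {1}/adj yij eqxx !mul0r big1 // => lam _.
  by rewrite [X in _ * X](bigD1 (i, j)) //= {1}/col yij eqxx mul0r mulr0.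
(* The lift reads [lam] at increasing pairs, so a pair reversed by [y] must hit the swapped color;
   [psym] undoes the swap. *)
pose iota (e : 'I_q * 'I_q) := if (y e.1 < y e.2)%N then (y e.1, y e.2) else (y e.2, y e.1).
pose tgt (e : 'I_q * 'I_q) := if (y e.1 < y e.2)%N then c e else swap (c e).
transitivity (\sum_(lam : {ffun 'I_n * 'I_n -> color}) (\prod_e pairw Q e (lam e)) *
    \prod_(e : 'I_q * 'I_q | (e.1 < e.2)%N) (lam (iota e) == tgt e)%:R).
  apply: eq_bigr => lam _; congr (_ * _); apply: eq_bigr => -[i j] /= ij.
  have ny : y i != y j by rewrite (inj_eq yi) neq_ltn ij.
  rewrite /col ny /iota /tgt !ffunE /=; case: (ltngtP (y i) (y j)) => [lt|lt|/val_inj e].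
  - by rewrite -surjective_pairing.
  - by rewrite -[in RHS](inj_eq (inv_inj swapK)) swapK.
  - by rewrite e eqxx in ny.
rewrite (indep_prod (P := fun e : 'I_q * 'I_q => (e.1 < e.2)%N)
  (fun e cc => (cc == tgt e)%:R)); first last.
- move=> [i j] [i' j'] /=; rewrite !unfold_in /= => ij ij'; rewrite /iota /=.
  case: ifP => _; case: ifP => _ [] /yi e1 /yi e2; subst => //.
    by have := ltn_trans ij ij'; rewrite ltnn.
  by have := ltn_trans ij ij'; rewrite ltnn.
- exact: pairw_sum.
apply: eq_bigr => -[i j] /= ij.
have ny : y i != y j by rewrite (inj_eq yi) neq_ltn ij.
rewrite (bigD1 (tgt (i, j))) //= eqxx mulr1 big1 ?addr0; last first.
  by move=> cc /negbTE ->; rewrite mulr0.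
rewrite /pairw /iota /tgt /adj ny /=; case: (ltngtP (y i) (y j)) => [lt|lt|/val_inj e] /=.
- by rewrite lt [G _ _ == _]eq_sym.
- by rewrite lt linked_swap psym Gsym [G _ _ == _]eq_sym.
- by rewrite e eqxx in ny.
Qed.

Variable rho : 'I_n -> Lb -> R.
Hypothesis rho1 : forall v, \sum_l rho v l = 1.

Lemma expect_label q (y : {ffun 'I_q -> 'I_n}) (h : {ffun 'I_q -> Lb} -> R) : injective y ->
  \sum_(Q : {ffun 'I_n -> Lb}) (\prod_v rho v (Q v)) * h [ffun s => Q (y s)] =
  \sum_(l : {ffun 'I_q -> Lb}) (\prod_s rho (y s) (l s)) * h l.
Proof.
move=> yi.
transitivity (\sum_(Q : {ffun 'I_n -> Lb}) \sum_(l : {ffun 'I_q -> Lb})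
   h l * ((\prod_v rho v (Q v)) * \prod_s (Q (y s) == l s)%:R)).
  apply: eq_bigr => Q _; rewrite [RHS](bigD1 ([ffun s => Q (y s)] : {ffun 'I_q -> Lb})) //=.
  rewrite [X in _ = _ + X]big1 ?addr0; last first.
    move=> l ne; have /existsP[s ns] : [exists s, Q (y s) != l s].
      apply: contraR ne; rewrite negb_exists => /forallP e; apply/eqP/ffunP => s.
      by rewrite ffunE; apply/esym/eqP; have := e s; rewrite negbK.
    by rewrite (bigD1 s (P := predT)) //= (negbTE ns) mul0r !mulr0.
  by rewrite [X in _ * (_ * X)]big1 ?mulr1 1?mulrC // => s _; rewrite ffunE eqxx.
rewrite exchange_big; apply: eq_bigr => l _; rewrite -mulr_sumr mulrC; congr (_ * _).
rewrite (indep_prod (P := predT) (fun s j => (j == l s)%:R)) //; last by move=> ? ? _ _ /yi.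
apply: eq_bigr => s _; rewrite (bigD1 (l s)) //= eqxx mulr1 big1 ?addr0 //.
by move=> j /negbTE ->; rewrite mulr0.
Qed.

Definition labelw (t : 'I_n * Lb) : R := @unif R 'I_n t.1 * rho t.1 t.2.

Lemma sum_labelw q (Phi : {ffun 'I_q -> 'I_n * Lb} -> R) :
  \sum_t prodw labelw t * Phi t =
  \sum_(y : {ffun 'I_q -> 'I_n}) prodw (@unif R _) y *
    \sum_(l : {ffun 'I_q -> Lb}) (\prod_s rho (y s) (l s)) * Phi [ffun s => (y s, l s)].
Proof.
pose j (p : {ffun 'I_q -> 'I_n} * {ffun 'I_q -> Lb}) : {ffun 'I_q -> 'I_n * Lb} :=
  [ffun s => (p.1 s, p.2 s)].
rewrite (reindex j); last first.
  exists (fun t : {ffun 'I_q -> 'I_n * Lb} => ([ffun s => (t s).1], [ffun s => (t s).2])).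
    by move=> -[y l] _; congr (_, _); apply/ffunP => s; rewrite !ffunE.
  by move=> t _; apply/ffunP => s; rewrite !ffunE -surjective_pairing.
transitivity (\sum_y \sum_l prodw labelw (j (y, l)) * Phi (j (y, l))).
  by rewrite pair_bigA /=; apply: eq_bigr => -[].
apply: eq_bigr => y _; rewrite mulr_sumr; apply: eq_bigr => l _.
rewrite mulrA; congr (_ * _); rewrite /prodw -big_split; apply: eq_bigr => s _.
by rewrite /labelw /j !ffunE.
Qed.

(** The lift disappears from the right-hand side, which is a pattern count for independent labelled
    nodes. The identity is exact because tuples with repeated nodes contribute 0 to both sides. *)
Lemma expect_random_lift q (c : 'I_q * 'I_q -> color) :
  \sum_(Q : {ffun 'I_n -> Lb}) (\prod_v rho v (Q v)) *
    \sum_(lam : {ffun 'I_n * 'I_n -> color}) (\prod_e pairw Q e (lam e)) *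
      \sum_(y : {ffun 'I_q -> 'I_n}) prodw (@unif R _) y *
        \prod_(e : 'I_q * 'I_q | (e.1 < e.2)%N) col (lift_cdg lam) (c e) (y e.1) (y e.2) =
  \sum_(t : {ffun 'I_q -> 'I_n * Lb}) prodw labelw t *
    \prod_(e : 'I_q * 'I_q | (e.1 < e.2)%N)
      (adj G (linked (c e)) (t e.1).1 (t e.2).1 * p (c e) (t e.1).2 (t e.2).2).
Proof.
rewrite sum_labelw.
pose h (y : {ffun 'I_q -> 'I_n}) (l : {ffun 'I_q -> Lb}) :=
  \prod_(e : 'I_q * 'I_q | (e.1 < e.2)%N)
    (adj G (linked (c e)) (y e.1) (y e.2) * p (c e) (l e.1) (l e.2)).
transitivity (\sum_(y : {ffun 'I_q -> 'I_n}) prodw (@unif R _) y *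
  \sum_(Q : {ffun 'I_n -> Lb}) (\prod_v rho v (Q v)) * h y [ffun s => Q (y s)]).
  transitivity (\sum_(Q : {ffun 'I_n -> Lb}) \sum_(y : {ffun 'I_q -> 'I_n})
     (\prod_v rho v (Q v)) * (prodw (@unif R _) y * h y [ffun s => Q (y s)])).
    apply: eq_bigr => Q _; rewrite -mulr_sumr; congr (_ * _).
    transitivity (\sum_(lam : {ffun 'I_n * 'I_n -> color}) \sum_(y : {ffun 'I_q -> 'I_n})
       prodw (@unif R _) y * ((\prod_e pairw Q e (lam e)) *
        \prod_(e : 'I_q * 'I_q | (e.1 < e.2)%N) col (lift_cdg lam) (c e) (y e.1) (y e.2))).
      by apply: eq_bigr => lam _; rewrite mulr_sumr; apply: eq_bigr => y _; rewrite mulrCA.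
    rewrite exchange_big; apply: eq_bigr => y _; rewrite -mulr_sumr expect_lift.
    by congr (_ * _); apply: eq_bigr => e _; rewrite !ffunE.
  rewrite exchange_big; apply: eq_bigr => y _; rewrite mulr_sumr.
  by apply: eq_bigr => Q _; rewrite mulrCA.
apply: eq_bigr => y _; congr (_ * _).
have -> : \sum_(l : {ffun 'I_q -> Lb}) (\prod_s rho (y s) (l s)) *
    \prod_(e : 'I_q * 'I_q | (e.1 < e.2)%N)
      (adj G (linked (c e)) ([ffun s => (y s, l s)] e.1).1 ([ffun s => (y s, l s)] e.2).1 *
       p (c e) ([ffun s => (y s, l s)] e.1).2 ([ffun s => (y s, l s)] e.2).2) =
   \sum_(l : {ffun 'I_q -> Lb}) (\prod_s rho (y s) (l s)) * h y l.
  by apply: eq_bigr => l _; congr (_ * _); apply: eq_bigr => e _; rewrite !ffunE.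
case: (boolP (injectiveb y)) => [/injectiveP yi|/injectivePn_lt[i [j [lt yij]]]].
  exact: expect_label.
have h0 l : h y l = 0.
  by rewrite /h (bigD1 (i, j)) //= {1}/adj yij eqxx !mul0r.
by rewrite !big1 // => ? _; rewrite h0 mulr0.
Qed.

End RandomLift.
End Patterns.

Lemma cut_norm_le_ext (R : realFieldType) (U : finType) (w : U -> R) (D D' : U -> U -> R) eps :
  (forall x y, D x y = D' x y) -> cut_norm_le w D eps -> cut_norm_le w D' eps.
Proof.
move=> e cut a b a1 b1; rewrite (eq_bigr (fun x => \sum_y w x * w y * (D x y * a x * b y))).
  exact: cut.
by move=> x _; apply: eq_bigr => y _; rewrite e.
Qed.

(** * Pattern frequencies in the sample and among randomly labelled nodes *)

Section Compare.
Variables (R : realType) (k m : nat).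
Notation color := ('I_k * 'I_k)%type.
Variables (n N : nat) (G : rel 'I_n) (G' : rel 'I_N) (iota : 'I_N -> 'I_n).
Variables (Tb Lb : finType) (W : 'I_n -> Tb) (P : 'I_N -> Lb) (l0 : Lb).
Variables (dd : bool -> Tb -> Tb -> R) (p : color -> Lb -> Lb -> R) (M : cdigraph k N).
Hypothesis n0 : (0 < n)%N.
Hypothesis N0 : (0 < N)%N.
Hypothesis dd01 : forall a s t, 0 <= dd a s t <= 1.
Hypothesis p01 : forall c i j, 0 <= p c i j <= 1.

Let wU := @unif R 'I_N.
Let wV := @unif R 'I_n.
Let pU : prob_weight wU. Proof. by apply: unif_prob; rewrite card_ord. Qed.
Let pV : prob_weight wV. Proof. by apply: unif_prob; rewrite card_ord. Qed.

Let piU := pushw (fun x => W (iota x)) wU.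
Let muU := pushw (fun x => (W (iota x), P x)) wU.

(* The label [l0] is only used on classes of [W] that the sample misses. *)
Definition label_dist (t : Tb) (l : Lb) : R :=
  if piU t == 0 then (l == l0)%:R else muU (t, l) / piU t.

Lemma piU_marginal t : piU t = \sum_l muU (t, l).
Proof.
rewrite /piU /muU /pushw (partition_big P xpredT) //=; apply: eq_bigr => l _.
Qed.

Lemma muU_ge0 s : 0 <= muU s.
Proof. by case: (pushw_prob (fun x => (W (iota x), P x)) pU). Qed.

Lemma piU_label_dist t l : piU t * label_dist t l = muU (t, l).
Proof.
rewrite /label_dist; case: eqP => [e|/eqP ne]; last by rewrite mulrC divfK.
rewrite e mul0r; apply/esym/eqP; move/eqP: e; rewrite piU_marginal psumr_eq0.
  by move=> /allP /(_ l); rewrite mem_index_enum => /(_ isT).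
by move=> *; apply: muU_ge0.
Qed.

Lemma label_dist_ge0 t l : 0 <= label_dist t l.
Proof.
rewrite /label_dist; case: ifP => _; first exact: ler0n.
by rewrite divr_ge0 ?muU_ge0 // piU_marginal sumr_ge0 // => ? _; apply: muU_ge0.
Qed.

Lemma label_dist_sum t : \sum_l label_dist t l = 1.
Proof.
rewrite /label_dist; case: (eqVneq (piU t) 0) => [_|ne].
  by rewrite (bigD1 l0) //= eqxx big1 ?addr0 // => l /negbTE ->.
by rewrite -mulr_suml -piU_marginal divff.
Qed.

Let rho v l := label_dist (W v) l.

(** On the sample the law of (class, label) is [piU t * label_dist t l], so the two laws differ only
    in the class weights. *)
Lemma push_labelw t l :
  pushw (fun s : 'I_n * Lb => (W s.1, s.2)) (labelw rho) (t, l) = pushw W wV t * label_dist t l.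
Proof.
rewrite /pushw mulr_suml big_mkcond /=.
rewrite -(pair_bigA _ (fun v l' =>
  if (W v, l') == (t, l) then wV v * label_dist (W v) l' else 0)) /=.
rewrite [RHS]big_mkcond; apply: eq_bigr => v _.
rewrite (bigD1 l) //= big1 ?addr0; last first.
  by move=> l' /negbTE ne; rewrite xpair_eqE ne andbF.
by rewrite xpair_eqE eqxx andbT; case: eqP => // ->.
Qed.

(** The four terms of the bound pay in turn for replacing colors of [M] by conditional densities,
    adjacency in the sample by class densities, the sample by labelled nodes of [G], and class
    densities by adjacency in [G]. The passage between the node sets happens where the integrand
    sees only classes and labels. *)
Lemma compare_pattern q (c : 'I_q * 'I_q -> color) (eps1 eta : R) : 0 <= eps1 ->
  (forall c, cut_norm_le wU (fun x y => col R M c x y - adj R G' (linked m c) x y * p c (P x) (P y)) eps1) ->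
  (forall a, cut_norm_le wU (fun x y => adj R G' a x y - dd a (W (iota x)) (W (iota y))) eta) ->
  (forall a, cut_norm_le wV (fun x y => adj R G a x y - dd a (W x) (W y)) eta) ->
  \sum_t `|piU t - pushw W wV t| <= eta ->
  `|\sum_z prodw wU z * \prod_(e : 'I_q * 'I_q | (e.1 < e.2)%N) col R M (c e) (z e.1) (z e.2)
   - \sum_(t : {ffun 'I_q -> 'I_n * Lb}) prodw (labelw rho) t *
       \prod_(e : 'I_q * 'I_q | (e.1 < e.2)%N)
         (adj R G (linked m (c e)) (t e.1).1 (t e.2).1 * p (c e) (t e.1).2 (t e.2).2)|
  <= (q * q)%:R * eps1 + (q * q)%:R * ((#|Lb| * #|Lb|)%:R * eta) + q%:R * eta
     + (q * q)%:R * ((#|Lb| * #|Lb|)%:R * eta).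
Proof.
move=> e10 cutM cutU cutV hpi.
have eta0 : 0 <= eta by apply: cut_norm_le_ge0 (cutV true).
have K0 : 0 <= (#|Lb| * #|Lb|)%:R * eta by rewrite mulr_ge0 ?ler0n.
have b01 (b : bool) : 0 <= (b%:R : R) <= 1 by case: b; rewrite ?lexx ler01.
have col01 c' x y : 0 <= col R M c' x y <= 1 by apply: b01.
have adjU01 a x y : 0 <= adj R G' a x y <= 1 by apply: b01.
have adjV01 a x y : 0 <= adj R G a x y <= 1 by apply: b01.
have m01 (x y : R) : 0 <= x <= 1 -> 0 <= y <= 1 -> 0 <= x * y <= 1.
  by move=> /andP[x0 x1] /andP[y0 y1]; rewrite mulr_ge0 // mulr_ile1.
have pn c' i j : `|p c' i j| <= 1.
  by have /andP[h0 h1] := p01 c' i j; rewrite ger0_norm.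
have pL : prob_weight (labelw rho).
  case: pV => v0 v1; split; first by move=> t; apply: mulr_ge0; [exact: (v0 t.1) | apply: label_dist_ge0].
  rewrite -(pair_bigA _ (fun v l => wV v * rho v l)) /= -v1.
  by apply: eq_bigr => v _; rewrite -mulr_sumr label_dist_sum mulr1.
pose psiU x := (W (iota x), P x).
pose psiV (s : 'I_n * Lb) := (W s.1, s.2).
pose Phi (s : {ffun 'I_q -> Tb * Lb}) := \prod_(e : 'I_q * 'I_q | (e.1 < e.2)%N)
  (dd (linked m (c e)) (s e.1).1 (s e.2).1 * p (c e) (s e.1).2 (s e.2).2).
have Phi01 s : 0 <= Phi s <= 1.
  apply: (big_ind (fun x : R => 0 <= x <= 1)); rewrite ?ler01 ?lexx //.
  by move=> e _; apply: m01.
set T1 := \sum_z _; set T5 := \sum_(t : {ffun 'I_q -> _}) _.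
pose T2 := \sum_(z : {ffun 'I_q -> 'I_N}) prodw wU z *
  \prod_(e : 'I_q * 'I_q | (e.1 < e.2)%N)
    (adj R G' (linked m (c e)) (z e.1) (z e.2) * p (c e) (P (z e.1)) (P (z e.2))).
pose T3 := \sum_(z : {ffun 'I_q -> 'I_N}) prodw wU z * Phi [ffun i => psiU (z i)].
pose T4 := \sum_(t : {ffun 'I_q -> 'I_n * Lb}) prodw (labelw rho) t * Phi [ffun i => psiV (t i)].
have d12 : `|T1 - T2| <= (q * q)%:R * eps1.
  apply: (counting (A := fun e => col R M (c e))
     (B := fun e x y => adj R G' (linked m (c e)) x y * p (c e) (P x) (P y))) => //.
  by move=> *; apply: m01.
have d23 : `|T2 - T3| <= (q * q)%:R * ((#|Lb| * #|Lb|)%:R * eta).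
  have -> : T3 = \sum_(z : {ffun 'I_q -> 'I_N}) prodw wU z *
    \prod_(e : 'I_q * 'I_q | (e.1 < e.2)%N)
     (dd (linked m (c e)) (W (iota (z e.1))) (W (iota (z e.2))) * p (c e) (P (z e.1)) (P (z e.2))).
    by apply: eq_bigr => z _; congr (_ * _); apply: eq_bigr => e _; rewrite !ffunE.
  apply: (counting
     (A := fun e x y => adj R G' (linked m (c e)) x y * p (c e) (P x) (P y))
     (B := fun e x y => dd (linked m (c e)) (W (iota x)) (W (iota y)) * p (c e) (P x) (P y))) => //.
  - by move=> *; apply: m01.
  - by move=> *; apply: m01.
  - move=> e _; have := cut_norm_le_labels P (cutU (linked m (c e))) (pn (c e)).
    by apply: cut_norm_le_ext => x y; rewrite mulrBl.
have d34 : `|T3 - T4| <= q%:R * eta.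
  rewrite /T3 /T4 !push_tuple.
  apply: le_trans (product_tv (pushw_prob _ pU) (pushw_prob _ pL) Phi01) _.
  rewrite ler_wpM2l ?ler0n //; apply: le_trans hpi.
  rewrite (eq_bigr (fun s : Tb * Lb => `|piU s.1 - pushw W wV s.1| * label_dist s.1 s.2)).
    rewrite -(pair_bigA _ (fun t l => `|piU t - pushw W wV t| * label_dist t l)) /=.
    by apply: ler_sum => t _; rewrite -mulr_sumr label_dist_sum mulr1.
  move=> [t l] _ /=; rewrite push_labelw -[pushw psiU _ _]piU_label_dist -mulrBl normrM.
  by rewrite (ger0_norm (label_dist_ge0 t l)).
have d45 : `|T4 - T5| <= (q * q)%:R * ((#|Lb| * #|Lb|)%:R * eta).
  have -> : T4 = \sum_(t : {ffun 'I_q -> 'I_n * Lb}) prodw (labelw rho) t *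
    \prod_(e : 'I_q * 'I_q | (e.1 < e.2)%N)
     (dd (linked m (c e)) (W (t e.1).1) (W (t e.2).1) * p (c e) (t e.1).2 (t e.2).2).
    by apply: eq_bigr => z _; congr (_ * _); apply: eq_bigr => e _; rewrite !ffunE.
  rewrite distrC; apply: (counting
     (A := fun e x y => adj R G (linked m (c e)) x.1 y.1 * p (c e) x.2 y.2)
     (B := fun e x y => dd (linked m (c e)) (W x.1) (W y.1) * p (c e) x.2 y.2)) => //.
  - by move=> *; apply: m01.
  - by move=> *; apply: m01.
  - move=> e _.
    have := cut_norm_le_labels (fun s : 'I_n * Lb => s.2)
      (cut_norm_le_marginal (cutV (linked m (c e))) (fun v => label_dist_ge0 (W v))
        (fun v => label_dist_sum (W v))) (pn (c e)).
    by apply: cut_norm_le_ext => x y; rewrite mulrBl.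
have tri (a b x y : R) : `|a| <= x -> `|b| <= y -> `|a + b| <= x + y.
  by move=> ha hb; apply: le_trans (ler_normD _ _) _; apply: lerD.
have -> : T1 - T5 = (T1 - T2) + (T2 - T3) + (T3 - T4) + (T4 - T5) by ring.
exact: (tri _ _ _ _ (tri _ _ _ _ (tri _ _ _ _ d12 d23) d34) d45).
Qed.

End Compare.

Lemma block_sym (R : realFieldType) (U Lb : finType) (w : U -> R) (P : U -> Lb) g i j :
  block w P g j i = block w P (fun x y => g y x) i j.
Proof.
rewrite /block exchange_big; do 2!apply: eq_bigr => ? _.
by rewrite [w _ * w _]mulrC.
Qed.

Lemma eq_block (R : realFieldType) (U Lb : finType) (w : U -> R) (P : U -> Lb) g g' i j :
  (forall x y, g x y = g' x y) -> block w P g i j = block w P g' i j.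
Proof. by move=> e; do 2!apply: eq_bigr => ? _; rewrite e. Qed.

Lemma shadow_sym k m n (L : cdigraph k n) G : is_shadow_of m L G -> forall u v, G u v = G v u.
Proof.
move=> /forallP h u v.
have /forallP/(_ v)/eqP <- := h u; have /forallP/(_ u)/eqP <- := h v.
by rewrite /shadow eq_sym orbC.
Qed.

Lemma shadow_linked k m n (L : cdigraph k n) G u v : is_shadow_of m L G -> u != v ->
  linked m (L (u, v), L (v, u)) = G u v.
Proof.
by move=> /forallP /(_ u) /forallP /(_ v) /eqP <- uv; rewrite /shadow uv.
Qed.

(** * Conditional color distributions of a partition *)

Section ColorDensity.
Variables (R : realType) (k m N : nat).
Notation color := ('I_k * 'I_k)%type.
Variables (c0 c1 : 'I_k) (G : rel 'I_N) (M : cdigraph k N) (Lb : finType) (P : 'I_N -> Lb).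
Hypothesis N0 : (0 < N)%N.
Hypothesis hM : is_shadow_of m M G.

Let w := @unif R 'I_N.
Let pw : prob_weight w. Proof. by apply: unif_prob; rewrite card_ord. Qed.

Definition default_color (a : bool) : color := if a then (c0, c0) else (c1, c1).

(* Blocks without pairs of the given adjacency get a default color, so that the
   distribution sums to [1] everywhere. *)
Definition color_density (c : color) i j : R :=
  if block w P (adj R G (linked m c)) i j == 0 then (c == default_color (linked m c))%:R
  else density w P (col R M c) (adj R G (linked m c)) i j.

Lemma adj_ge0 (U : finType) (H : rel U) a x y : 0 <= adj R H a x y.
Proof. exact: ler0n. Qed.

Lemma adj_le1 (U : finType) (H : rel U) a x y : adj R H a x y <= 1.
Proof. by rewrite /adj; case: (_ && _); rewrite ?ler01. Qed.

Lemma col_ge0 c x y : 0 <= col R M c x y.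
Proof. exact: ler0n. Qed.

Lemma col_le_adj c x y : col R M c x y <= adj R G (linked m c) x y.
Proof.
rewrite /col /adj; case: (eqVneq x y) => //= ne; case: eqP => [<-|_]; last exact: ler0n.
by rewrite (shadow_linked hM) // eqxx.
Qed.

Lemma color_density_bounds c i j : 0 <= color_density c i j <= 1.
Proof.
rewrite /color_density; case: ifP => _.
  by case: eqP; rewrite ?lexx ler01.
exact: (density_bounds pw (col_ge0 c) (col_le_adj c)).
Qed.

Lemma color_density_swap c i j : color_density (swap c) j i = color_density c i j.
Proof.
have bs : block w P (adj R G (linked m (swap c))) j i = block w P (adj R G (linked m c)) i j.
  rewrite linked_swap block_sym; apply: eq_block => x y.
  by rewrite /adj eq_sym (shadow_sym hM).
rewrite /color_density /density bs linked_swap; congr (if _ then _ else _ / _).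
  by rewrite -(inj_eq (inv_inj (@swapK k))) swapK; case: linked.
rewrite block_sym; apply: eq_block => x y.
by rewrite /col eq_sym -(inj_eq (inv_inj (@swapK k))) swapK.
Qed.

Lemma color_density_sum a i j : linked m (default_color a) = a ->
  \sum_(c | linked m c == a) color_density c i j = 1.
Proof.
move=> da; rewrite /color_density.
rewrite (eq_bigr (fun c => if block w P (adj R G a) i j == 0 then (c == default_color a)%:R
    else block w P (col R M c) i j / block w P (adj R G a) i j)); last first.
  by move=> c /eqP ->.
case: (eqVneq (block w P (adj R G a) i j) 0) => [_|ne].
  rewrite (bigD1 (default_color a)) ?da //= eqxx big1 ?addr0 // => c /andP[_].
  by move=> /negbTE ->.
rewrite -mulr_suml; suff -> : \sum_(c | linked m c == a) block w P (col R M c) i j =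
  block w P (adj R G a) i j by rewrite divff.
rewrite exchange_big; apply: eq_bigr => x _; rewrite exchange_big; apply: eq_bigr => y _.
rewrite -mulr_sumr; congr (_ * _); rewrite /col /adj.
case: (eqVneq x y) => [_|xy] /=; first by rewrite big1.
rewrite -(shadow_linked hM xy); case: (boolP (linked m _ == a)) => h.
  rewrite (bigD1 (M (x, y), M (y, x))) //= eqxx big1 ?addr0 // => c /andP[_].
  by rewrite eq_sym => /negbTE ->.
by rewrite big1 // => c hc; case: eqP => // e; move: h; rewrite e hc.
Qed.

(** The default colors are invisible here: a block of weight 0 contains no pair of the given
    adjacency, since every node has positive weight. *)
Lemma adj_color_density c x y :
  adj R G (linked m c) x y * density w P (col R M c) (adj R G (linked m c)) (P x) (P y) =
  adj R G (linked m c) x y * color_density c (P x) (P y).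
Proof.
rewrite /color_density; case: eqP => // /eqP b0.
suff -> : adj R G (linked m c) x y = 0 by rewrite !mul0r.
have wx z : w z != 0 by rewrite /w /unif card_ord invr_eq0 pnatr_eq0 -lt0n.
have w0 z : 0 <= w z by case: pw.
have t0 x' y' : 0 <= w x' * w y' * adj R G (linked m c) x' y'.
  by rewrite !mulr_ge0 ?adj_ge0.
move: b0; rewrite /block psumr_eq0; last by move=> ? _; apply: sumr_ge0.
move=> /allP /(_ x); rewrite mem_index_enum eqxx => /(_ isT) /=.
rewrite psumr_eq0; last by move=> ? _.
move=> /allP /(_ y); rewrite mem_index_enum eqxx => /(_ isT) /=.
by rewrite !mulf_eq0 !(negbTE (wx _)) => /eqP.
Qed.

End ColorDensity.

(** * Existence of a lift with the sample frequencies of [M] *)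

Section Transfer.
Variables (R : realType) (k m : nat).
Hypothesis hm : (1 <= m)%N.
Hypothesis hkm : (m <= k)%N.
Notation color := ('I_k * 'I_k)%type.

Lemma k_gt0 : (0 < k)%N. Proof. exact: leq_trans hm hkm. Qed.

Definition color0 : 'I_k := Ordinal k_gt0.

Lemma klast_subproof : (k.-1 < k)%N. Proof. by rewrite ltn_predL k_gt0. Qed.

Definition color_last : 'I_k := Ordinal klast_subproof.

(** If some color is at least [m], then so is the last one, being the largest. *)
Lemma linked_default a : (exists c : color, linked m c = a) ->
  linked m (default_color color0 color_last a) = a.
Proof.
case: a => [_|[[c d]]]; rewrite /linked /= ?hm // orbb => h.
have [cm dm] : (m <= c)%N /\ (m <= d)%N.
  by move/negbT: h; rewrite negb_or -!leqNgt => /andP[].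
apply/negbTE; rewrite -leqNgt; apply: leq_trans cm _.
by rewrite -ltnS prednK ?k_gt0.
Qed.

Definition sample_freq (c : 'I_k) q n (L : cdigraph k n) (Fs : pred (cdigraph k q)) : R :=
  \sum_(y : {ffun 'I_q -> 'I_n}) prodw (@unif R _) y *
    (injectiveb y && Fs (normal c (pull L y)))%:R.

(** [eta] depends only on [q], [theta], [k], and not on the number of classes of [W]; this permits
    choosing [W] afterwards with accuracy dictated by [eta]. *)
Lemma transfer q (theta : R) : 0 < theta -> exists2 eta : R, 0 < eta &
  forall n N (G : rel 'I_n) (G' : rel 'I_N) (iota : 'I_N -> 'I_n)
    (Tb : finType) (W : 'I_n -> Tb) (dd : bool -> Tb -> Tb -> R) (M : cdigraph k N),
  (0 < n)%N -> (0 < N)%N -> simple_graph G -> @has_shadow k m n G ->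
  (forall a s t, 0 <= dd a s t <= 1) ->
  (forall a, cut_norm_le (@unif R _) (fun x y => adj R G' a x y - dd a (W (iota x)) (W (iota y))) eta) ->
  (forall a, cut_norm_le (@unif R _) (fun x y => adj R G a x y - dd a (W x) (W y)) eta) ->
  \sum_t `|pushw (fun x => W (iota x)) (@unif R _) t - pushw W (@unif R _) t| <= eta ->
  is_shadow_of m M G' ->
  forall Fs : pred (cdigraph k q), exists2 L : cdigraph k n, is_shadow_of m L G &
    sample_freq color0 M Fs - theta <= sample_freq color0 L Fs.
Proof.
move=> th0.
(* Each pattern may cost [theta / NF], and there are fewer than [NF] patterns. The bound of
   [compare_pattern] becomes [(3 * q ^ 2 + q) * eps1], at most [4 * D * eps1]. *)
pose D : nat := (q * q + q + 1)%N; pose NF : nat := #|cdigraph k q|.+1.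
have D0 : 0 < D%:R :> R by rewrite ltr0n /D addn1.
have NF0 : 0 < NF%:R :> R by rewrite ltr0n.
pose eps1 : R := theta / (4 * NF%:R * D%:R).
have e1 : 0 < eps1 by rewrite divr_gt0 // !mulr_gt0.
have [N1 hN1] : exists N1 : nat, #|{: color}|%:R < N1%:R * (eps1 / 4) ^+ 2.
  have s0 : 0 < (eps1 / 4) ^+ 2 by rewrite exprn_gt0 // divr_gt0.
  have [N1 [_ h]] := nat_gt (#|{: color}|%:R / (eps1 / 4) ^+ 2).
  by exists N1; rewrite -ltr_pdivrMr.
(* Bounds [#|Lb| ^ 2], the loss in [cut_norm_le_labels]. *)
pose K : nat := (4 ^ N1 * 4 ^ N1)%N.
exists (eps1 / K.+1%:R); first by rewrite divr_gt0 ?ltr0n.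
set eta := eps1 / _ => n N G G' iota Tb W dd M n0 N0 [Gsym Girr] [L0 hL0] dd01 cutU cutV hpi hM Fs.
have eta0 : 0 < eta by rewrite divr_gt0 ?ltr0n.
have pU : prob_weight (@unif R 'I_N) by apply: unif_prob; rewrite card_ord.
have [Lb [P [cL reg]]] := weak_regularity e1 hN1 pU (col_ge0 R M) (col_le_adj R hM)
  (fun c => adj_le1 R G' (linked m c)).
pose p := color_density R m color0 color_last G' M P.
have p01 c i j : 0 <= p c i j <= 1 by apply: color_density_bounds.
have p0 c i j : 0 <= p c i j by case/andP: (p01 c i j).
have psym c i j : p (swap c) j i = p c i j by apply: color_density_swap.
have psum u v : u != v -> forall i j, \sum_(c | linked m c == G u v) p c i j = 1.
  move=> uv i j; apply: color_density_sum => //; apply: linked_default.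
  by exists (L0 (u, v), L0 (v, u)); rewrite (shadow_linked hL0).
have cutM c : cut_norm_le (@unif R 'I_N)
    (fun x y => col R M c x y - adj R G' (linked m c) x y * p c (P x) (P y)) eps1.
  by apply: cut_norm_le_ext (reg c) => x y; rewrite (adj_color_density R m color0 color_last).
pose l0 := P (Ordinal N0).
pose rho v l := label_dist R iota W P l0 (W v) l.
have rho0 v l : 0 <= rho v l by apply: label_dist_ge0.
have rho1 v : \sum_l rho v l = 1 by apply: label_dist_sum.
pose T5 (c : 'I_q * 'I_q -> color) :=
  \sum_(t : {ffun 'I_q -> 'I_n * Lb}) prodw (labelw rho) t *
    \prod_(e : 'I_q * 'I_q | (e.1 < e.2)%N)
      (adj R G (linked m (c e)) (t e.1).1 (t e.2).1 * p (c e) (t e.1).2 (t e.2).2).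
pose T1 (c : 'I_q * 'I_q -> color) := \sum_z prodw (@unif R 'I_N) z *
    \prod_(e : 'I_q * 'I_q | (e.1 < e.2)%N) col R M (c e) (z e.1) (z e.2).
have cmp c : T1 c - T5 c <= theta / NF%:R.
  apply: le_trans (ler_norm _) _.
  apply: le_trans (compare_pattern l0 n0 N0 dd01 p01 c (ltW e1) cutM cutU cutV hpi) _.
  have h1 : (#|Lb| * #|Lb|)%:R * eta <= eps1.
    rewrite /eta mulrA ler_pdivrMr ?ltr0n // mulrC ler_wpM2l ?(ltW e1) // ler_nat.
    by apply: leqW; apply: leq_mul.
  have h2 : eta <= eps1 by rewrite /eta ler_pdivrMr ?ltr0n // ler_peMr ?(ltW e1) // ler1n.
  have -> : theta / NF%:R = 4 * (D%:R * eps1).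
    rewrite /eps1; field; rewrite ?(gt_eqF D0) ?(gt_eqF NF0) //.
  have DE : D%:R = (q * q)%:R + q%:R + 1 :> R by rewrite /D !natrD.
  have g1 := ler_wpM2l (ler0n R (q * q)) h1.
  have g2 := ler_wpM2l (ler0n R q) h2.
  have g3 : 0 <= (q * q)%:R * eps1 by rewrite mulr_ge0 ?ler0n ?ltW.
  have g4 : 0 <= q%:R * eps1 by rewrite mulr_ge0 ?ler0n ?ltW.
  rewrite DE !mulrDl mul1r; lra.
pose normals (F : cdigraph k q) := Fs F && (normal color0 F == F).
have gf n' (L : cdigraph k n') : sample_freq color0 L Fs =
    \sum_(F | normals F) \sum_y prodw (@unif R _) y *
      \prod_(e : 'I_q * 'I_q | (e.1 < e.2)%N) col R L (pair_colors F e) (y e.1) (y e.2).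
  rewrite exchange_big; apply: eq_bigr => y _; rewrite -mulr_sumr.
  by rewrite sum_patterns.
have avg : sample_freq color0 M Fs - theta <=
    \sum_(Q : {ffun 'I_n -> Lb}) (\prod_v rho v (Q v)) *
    \sum_(lam : {ffun 'I_n * 'I_n -> color}) (\prod_e pairw m G p color0 Q e (lam e)) *
      sample_freq color0 (lift_cdg lam) Fs.
  have -> : \sum_(Q : {ffun 'I_n -> Lb}) (\prod_v rho v (Q v)) *
    (\sum_(lam : {ffun 'I_n * 'I_n -> color}) (\prod_e pairw m G p color0 Q e (lam e)) *
      sample_freq color0 (lift_cdg lam) Fs) = \sum_(F | normals F) T5 (pair_colors F).
    rewrite (eq_bigr (fun F => _) (fun F _ =>
      esym (expect_random_lift color0 Gsym psym psum rho1 (pair_colors F)))).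
    rewrite [RHS]exchange_big; apply: eq_bigr => Q _; rewrite -mulr_sumr; congr (_ * _).
    rewrite [RHS]exchange_big; apply: eq_bigr => lam _; rewrite -mulr_sumr; congr (_ * _).
    exact: gf.
  rewrite gf lerBlDr -lerBlDl -sumrB.
  apply: (@le_trans _ _ (\sum_(F : cdigraph k q | normals F) theta / NF%:R)).
    by apply: ler_sum => F _; apply: cmp.
  rewrite sumr_const -[leLHS]mulr_natl mulrCA ler_piMr ?(ltW th0) //.
  rewrite ler_pdivrMr // mul1r ler_nat; apply: leqW; exact: max_card.
have pQ : prob_weight (fun Q : {ffun 'I_n -> Lb} => \prod_v rho v (Q v)).
  split; first by move=> Q; apply: prodr_ge0.
  by rewrite -(bigA_distr_bigA rho) big1.
have [Q _ {}avg] := wsum_exists pQ avg.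
have pl : prob_weight (fun lam : {ffun 'I_n * 'I_n -> color} =>
    \prod_e pairw m G p color0 Q e (lam e)).
  split; first by move=> lam; apply: prodr_ge0 => e _; apply: pairw_ge0.
  rewrite -(bigA_distr_bigA (pairw m G p color0 Q)) big1 // => e _.
  exact: pairw_sum.
have [lam lam0 {}avg] := wsum_exists pl avg.
by exists (lift_cdg lam) => //; apply: lift_shadow lam0.
Qed.

End Transfer.

(** * Fluctuation of class sizes *)

Section Deviation.
Variables (R : realFieldType) (V Tb : finType) (W : V -> Tb).

Lemma pushw_indicator (w : V -> R) t : pushw W w t = \sum_x w x * (W x == t)%:R.
Proof.
rewrite /pushw big_mkcond; apply: eq_bigr => x _.
by case: eqP; rewrite ?mulr1 ?mulr0.
Qed.

(** A kernel whose mean over pairs is the squared Euclidean distance of class weights; the l1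
    distance itself is not a tuple average. *)
Definition deviation (pi : Tb -> R) x y : R :=
  \sum_t ((W x == t)%:R - pi t) * ((W y == t)%:R - pi t).

Lemma sum_deviation (w : V -> R) (pi : Tb -> R) : prob_weight w ->
  sum2 w (deviation pi) = \sum_t (pushw W w t - pi t) ^+ 2.
Proof.
move=> [w0 w1].
transitivity (\sum_x \sum_t \sum_y
  w x * w y * (((W x == t)%:R - pi t) * ((W y == t)%:R - pi t))).
  apply: eq_bigr => x _; rewrite exchange_big; apply: eq_bigr => y _.
  by rewrite mulr_sumr.
rewrite exchange_big; apply: eq_bigr => t _ /=.
have -> : pushw W w t - pi t = \sum_x w x * ((W x == t)%:R - pi t).
  under eq_bigr do rewrite mulrBr.
  by rewrite sumrB -mulr_suml w1 mul1r pushw_indicator.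
rewrite expr2 mulr_suml; apply: eq_bigr => x _; rewrite mulr_sumr.
by apply: eq_bigr => y _; ring.
Qed.

Lemma deviation_norm (pi : Tb -> R) x y : (forall t, 0 <= pi t <= 1) ->
  `|deviation pi x y| <= #|Tb|%:R.
Proof.
move=> p01; apply: le_trans (ler_norm_sum _ _ _) _.
rewrite -sumr_const; apply: ler_sum => t _; apply: norm_mul_le1.
  by have := p01 t; case: (_ == _) => /=; rewrite ler_norml; lra.
by have := p01 t; case: (_ == _) => /=; rewrite ler_norml; lra.
Qed.

End Deviation.

Lemma pushw_enum_val (R : realFieldType) n (X : {set 'I_n}) (Tb : finType) (W : 'I_n -> Tb) t :
  pushw (fun i => W (enum_val i)) (@unif R 'I_#|X|) t = pushw W (@setw R _ X) t.
Proof.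
by rewrite !pushw_indicator (sum_enum_val X (fun x => (W x == t)%:R)).
Qed.

Lemma prob_union (R : realType) n r (P P1 P2 : {set 'I_n} -> bool) (d1 d2 : R) :
  (forall X : {set 'I_n}, #|X| = r -> P X -> P1 X || P2 X) ->
  @prob_rsubset R n r P1 < d1 -> @prob_rsubset R n r P2 < d2 ->
  @prob_rsubset R n r P < d1 + d2.
Proof.
move=> sub lt1 lt2; apply: le_lt_trans (ltrD lt1 lt2).
rewrite /prob_rsubset -mulrDl ler_wpM2r ?invr_ge0 ?ler0n // -natrD ler_nat.
apply: leq_trans (leq_card_setU _ _).
apply: subset_leq_card; apply/subsetP => X; rewrite !inE => /andP[cX PX].
by rewrite cX /= sub // (eqP cX).
Qed.

(** * The parameter [shadow_max] *)

Section ShadowMax.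
Variables (R : realType) (k m : nat) (g : forall n, cdigraph k n -> R).

Lemma shadow_max_ge n (G : rel 'I_n) L : is_shadow_of m L G -> g L <= shadow_max m g G.
Proof.
move=> hL; rewrite /shadow_max; case: pickP => [L0 _|none]; last by rewrite none in hL.
exact: le_bigmax_cond.
Qed.

Lemma shadow_max_attained n (G : rel 'I_n) : @has_shadow k m n G ->
  exists2 L : cdigraph k n, is_shadow_of m L G & shadow_max m g G = g L.
Proof.
move=> [L hL]; rewrite /shadow_max; case: pickP => [L0 hL0|none]; last by rewrite none in hL.
apply: (big_ind (fun x => exists2 L1 : cdigraph k n, is_shadow_of m L1 G & x = g L1)).
- by exists L0.
- move=> x y [L1 h1 ->] [L2 h2 ->].
  by rewrite maxEle; case: ifP => _; [exists L2 | exists L1].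
- by move=> L1 h1; exists L1.
Qed.

Lemma induced_shadow n (G : rel 'I_n) (L : cdigraph k n) (X : {set 'I_n}) :
  is_shadow_of m L G -> is_shadow_of m (induced_cdg L X) (induced_graph G X).
Proof.
move=> /forallP h; apply/forallP => u; apply/forallP => v; apply/eqP.
rewrite /induced_graph; have /forallP/(_ (enum_val v))/eqP <- := h (enum_val u).
by rewrite /shadow !ffunE /= (inj_eq enum_val_inj).
Qed.

Lemma normal_iso (c0 : 'I_k) q (L : cdigraph k q) : cdg_param g -> g (normal c0 L) = g L.
Proof.
move=> [_ inv]; apply: (inv q 1%g) => u v uv.
by rewrite !perm1 ffunE /= (negbTE uv).
Qed.

End ShadowMax.

(** * Upper bound for the value on a random sample *)

Section Upper.
Variables (R : realType) (k m : nat).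
Hypothesis hm : (1 <= m)%N.
Hypothesis hkm : (m <= k)%N.
Variable g : forall n, cdigraph k n -> R.
Hypothesis hg : cdg_estimable g.

Let c0 := color0 hm hkm.

Lemma sample_freq_test n q (L : cdigraph k n) (eps d : R) : (0 < n)%N ->
  \sum_(y : {ffun 'I_q -> 'I_n}) prodw (@unif R _) y * (bad_sample g eps L y)%:R < d ->
  1 - d < sample_freq R c0 L (fun F : cdigraph k q => `|g L - g F| <= eps).
Proof.
move=> n0 lt; have pu : prob_weight (@unif R 'I_n) by apply: unif_prob; rewrite card_ord.
rewrite ltrBlDr; apply: le_lt_trans (_ : _ <= sample_freq R c0 L
  (fun F : cdigraph k q => `|g L - g F| <= eps) + \sum_(y : {ffun 'I_q -> 'I_n})
    prodw (@unif R _) y * (bad_sample g eps L y)%:R) _; last by rewrite ltrD2l.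
rewrite /sample_freq -big_split -{1}(sum_prodw q pu); apply: ler_sum => y _ /=.
rewrite -mulrDr ler_peMr ?prodw_ge0 // normal_iso; last by case: hg.
by rewrite /bad_sample; case: (_ && _); rewrite ?addr0 ?add0r.
Qed.

(** Events of total probability above 1 intersect, so one sample [F] has [g F] within [eps] of both
    values. *)
Lemma sample_freq_close n N q (L : cdigraph k n) (M : cdigraph k N) (eps a b : R) : (0 < n)%N ->
  1 < a + b ->
  a <= sample_freq R c0 L (fun F : cdigraph k q => `|g L - g F| <= eps) ->
  b <= sample_freq R c0 L (fun F : cdigraph k q => `|g M - g F| <= eps) ->
  g M <= g L + eps + eps.
Proof.
move=> n0 ab ha hb; have pu : prob_weight (@unif R 'I_n) by apply: unif_prob; rewrite card_ord.
have [//|lt] := leP (g M) (g L + eps + eps); exfalso.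
have : a + b <= 1.
  apply: le_trans (lerD ha hb) _; rewrite /sample_freq -big_split -[leRHS](sum_prodw q pu).
  apply: ler_sum => y _ /=; rewrite -mulrDr ler_piMr ?prodw_ge0 //.
  case: (injectiveb y); rewrite ?addr0 ?ler01 //=.
  case: (leP `|g L - _| eps); case: (leP `|g M - _| eps); rewrite ?addr0 ?add0r ?lexx ?ler01 //.
  by rewrite !ler_norml => h1 h2; exfalso; lra.
lra.
Qed.

Lemma shadow_max_upper (eps delta : R) : 0 < eps -> 0 < delta ->
  exists r0 : nat, forall r n (G : rel 'I_n), (r0 <= r)%N -> (r <= n)%N ->
  simple_graph G -> @has_shadow k m n G ->
  @prob_rsubset R n r
    (fun X => shadow_max m g G + eps < shadow_max m g (induced_graph G X)) < delta.
Proof.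
move=> e0 d0; have e2 : 0 < eps / 2 by rewrite divr_gt0.
(* The tests on [L] and [M] succeed with frequency above 3/4 and the transfer loses 1/4, which
   leaves [3 / 4 + 1 / 2 > 1]. *)
have q4 : 0 < (1 / 4 : R) by rewrite divr_gt0.
have [q [n0 [n00 test]]] := tuple_test hg e2 q4.
have [eta eta0 tr] := transfer hm hkm q q4.
have eta4 : 0 < eta ^+ 4 by rewrite exprn_gt0.
(* The box norms for the two adjacency values add up to at most [eta ^+ 4 * delta / 4]; an equal
   share is left for the sampling error in Markov's inequality at threshold [eta ^+ 4]. *)
pose eta2 := Order.min eta (eta ^+ 4 * delta / 8).
have eta20 : 0 < eta2 by rewrite lt_min eta0 divr_gt0 // mulr_gt0.
have [N2 hN2] : exists N2 : nat, #|{: bool}|%:R < N2%:R * (eta2 / 4) ^+ 2.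
  have s0 : 0 < (eta2 / 4) ^+ 2 by rewrite exprn_gt0 // divr_gt0.
  have [N2 [_ h]] := nat_gt (#|{: bool}|%:R / (eta2 / 4) ^+ 2).
  by exists N2; rewrite -ltr_pdivrMr.
pose T : R := (4 ^ N2)%:R.
have T1 : 0 < T by rewrite ltr0n expn_gt0.
(* With at most [T] classes, an l1 deviation above [eta] forces some class to deviate by more than
   [eta / T]. *)
pose t2 : R := (eta / T) ^+ 2.
have t20 : 0 < t2 by rewrite exprn_gt0 // divr_gt0.
have [r1 [r10 hr1]] := nat_gt (4 * 2 * (4 * 4)%:R / (eta ^+ 4 * delta / 4)).
have [r2 [r20 hr2]] := nat_gt (4 * T * (2 * 2)%:R / (t2 * (delta / 2))).
exists (maxn n0 (maxn r1 r2)) => r n G; rewrite !geq_max => /and3P[n0r r1r r2r] rn sG hG.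
have r0 : (0 < r)%N := leq_trans r10 r1r.
have n1 : (0 < n)%N := leq_trans r0 rn.
have rR : 0 < r%:R :> R by rewrite ltr0n.
have pu : prob_weight (@unif R 'I_n) by apply: unif_prob; rewrite card_ord.
have adj0 a x y : 0 <= adj R G a x y by exact: ler0n.
have adj1 a x y : adj R G a x y <= 1 by rewrite /adj; case: (_ && _); rewrite ?ler01.
have [Tb [W [cT reg]]] := weak_regularity eta20 hN2 pu adj0 adj1
  (fun (_ : bool) _ _ => lexx 1).
pose dd a := density (@unif R 'I_n) W (adj R G a) (fun _ _ => 1).
have dd01 a s t : 0 <= dd a s t <= 1.
  exact: (density_bounds pu (adj0 a) (adj1 a)).
pose D a x y := adj R G a x y - dd a (W x) (W y).
have cutD a : cut_norm_le (@unif R 'I_n) (D a) eta2.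
  by apply: cut_norm_le_ext (reg a) => x y; rewrite mul1r.
have D1 a x y : `|D a x y| <= 1.
  have /andP[u0 u1] := dd01 a (W x) (W y); have := adj0 a x y; have := adj1 a x y.
  by rewrite /D ler_norml; move=> *; apply/andP; split; lra.
pose piV := pushw W (@unif R 'I_n).
have piV01 t : 0 <= piV t <= 1.
  case: (pushw_prob W pu) => p0 p1; rewrite p0 /= -p1 (bigD1 t) //= lerDl.
  by apply: sumr_ge0 => s _; apply: p0.
have px (X : {set 'I_n}) : #|X| = r -> prob_weight (@setw R _ X).
  by move=> cX; apply: setw_prob; rewrite cX.
have P1 : @prob_rsubset R n r (fun X => [exists a, eta ^+ 4 < box (@setw R _ X) (D a)]) < delta / 2.
  pose H z := box_kernel (D true) z + box_kernel (D false) z.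
  have HE w : prob_weight w -> \sum_z prodw w z * H z = box w (D true) + box w (D false).
    move=> pw; rewrite -!sum_box_kernel // -big_split; apply: eq_bigr => z _.
    by rewrite mulrDr.
  apply: (@sampling_prob R n r 4 H 2 (eta ^+ 4)) => //.
  - move=> z; apply: le_trans (ler_normD _ _) _.
    by rewrite -[2]/(1 + 1); apply: lerD; apply: box_kernel_norm.
  - by move=> X /px pX; rewrite HE // addr_ge0 // box_ge0.
  - move=> X /px pX /existsP[a ha]; rewrite HE //.
    have := box_ge0 pX (D true); have := box_ge0 pX (D false).
    by case: a ha; lra.
  rewrite HE //.
  have b a := box_le_cut pu (D1 a) (cutD a).
  have bt := b true; have bf := b false.
  have : eta2 <= eta ^+ 4 * delta / 8 by rewrite ge_min lexx orbT.
  have : 4 * 2 * (4 * 4)%:R / r%:R < eta ^+ 4 * delta / 4.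
    rewrite ltr_pdivrMr // [ltRHS]mulrC -ltr_pdivrMr ?divr_gt0 ?mulr_gt0 //.
    by apply: lt_le_trans hr1 _; rewrite ler_nat.
  lra.
have P2 : @prob_rsubset R n r
    (fun X => eta < \sum_t `|pushw W (@setw R _ X) t - piV t|) < delta / 2.
  pose H (z : {ffun 'I_2 -> 'I_n}) := deviation W piV (z ord0) (z ord_max).
  have HE w : prob_weight w -> \sum_z prodw w z * H z = \sum_t (pushw W w t - piV t) ^+ 2.
    by move=> pw; rewrite (sum_prodw2 (deviation W piV) pw) sum_deviation.
  apply: (@sampling_prob R n r 2 H T t2) => //.
  - move=> z; apply: le_trans (deviation_norm W _ _ piV01) _.
    by rewrite ler_nat.
  - by move=> X /px pX; rewrite HE // sumr_ge0 // => t _; rewrite sqr_ge0.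
  - move=> X /px pX; rewrite HE // leNgt; apply: contraTN => lt; rewrite -leNgt.
    apply: (@le_trans _ _ (\sum_(t : Tb) eta / T)).
      apply: ler_sum => t _; rewrite -(@ler_pXn2r _ 2) ?nnegrE ?divr_ge0 ?(ltW T1) ?(ltW eta0) //.
      rewrite real_normK ?num_real //; apply: le_trans (ltW lt).
      by rewrite (bigD1 t) //= lerDl sumr_ge0 // => s _; rewrite sqr_ge0.
    rewrite sumr_const -[leLHS]mulr_natl mulrCA ler_piMr ?(ltW eta0) //.
    by rewrite ler_pdivrMr // mul1r ler_nat.
  (* On the full node set the deviation is exactly 0, so only the sampling error remains. *)
  rewrite HE // big1 ?add0r; last by move=> t _; rewrite subrr expr0n.
  have td : 0 < t2 * (delta / 2) by rewrite mulr_gt0 // divr_gt0.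
  rewrite ltr_pdivrMr // [ltRHS]mulrC -ltr_pdivrMr //.
  by apply: lt_le_trans hr2 _; rewrite ler_nat.
have -> : delta = delta / 2 + delta / 2 by field.
apply: prob_union P1 P2 => X cX; apply: contraTT; rewrite negb_or -!leNgt => /andP[nbox dev].
have {}nbox a : box (@setw R _ X) (D a) <= eta ^+ 4.
  by rewrite leNgt; apply: contra nbox => h; apply/existsP; exists a.
have X0 : (0 < #|X|)%N by rewrite cX.
have pX : prob_weight (@unif R 'I_#|X|) by apply: unif_prob; rewrite card_ord.
have hGX : @has_shadow k m _ (induced_graph G X).
  by case: hG => L hL; exists (induced_cdg L X); apply: induced_shadow.
have [M hM ->] := shadow_max_attained g hGX.
have cutU a : cut_norm_le (@unif R 'I_#|X|)
    (fun x y => adj R (induced_graph G X) a x y - dd a (W (enum_val x)) (W (enum_val y))) eta.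
  apply: cut_norm_le_ext (_ : cut_norm_le _ (fun x y => D a (enum_val x) (enum_val y)) _).
    by move=> x y; rewrite /D /adj (inj_eq enum_val_inj).
  by apply: cut_le_box; rewrite ?(ltW eta0) // box_enum_val.
have cutV a : cut_norm_le (@unif R 'I_n) (fun x y => adj R G a x y - dd a (W x) (W y)) eta.
  move=> u v u1 v1; apply: le_trans (cutD a u v u1 v1) _.
  by rewrite ge_min lexx.
have dev' : \sum_t `|pushw (fun x => W (enum_val x)) (@unif R 'I_#|X|) t - piV t| <= eta.
  by rewrite (eq_bigr (fun t => `|pushw W (@setw R _ X) t - piV t|)) // => t _;
     rewrite pushw_enum_val.
have [L hL fracL] := tr _ _ _ _ _ _ _ _ _ n1 X0 sG hG dd01 cutU cutV dev' hM
  (fun F : cdigraph k q => `|g M - g F| <= eps / 2).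
have tM : 1 - 1 / 4 < sample_freq R c0 M (fun F : cdigraph k q => `|g M - g F| <= eps / 2).
  by apply: sample_freq_test => //; apply: test; rewrite cX.
have tL : 1 - 1 / 4 < sample_freq R c0 L (fun F : cdigraph k q => `|g L - g F| <= eps / 2).
  by apply: sample_freq_test => //; apply: test; apply: leq_trans n0r rn.
have fL : 1 / 2 <= sample_freq R c0 L (fun F : cdigraph k q => `|g M - g F| <= eps / 2).
  by apply: le_trans fracL; rewrite -/c0; lra.
have ab : 1 < (1 - 1 / 4) + 1 / 2 :> R by lra.
have := sample_freq_close n1 ab (ltW tL) fL.
have := shadow_max_ge g hL; lra.
Qed.

End Upper.

(** * Invariance of the shadow maximum, and the conclusion *)

Section Param.
Variables (R : realType) (k m : nat) (g : forall n, cdigraph k n -> R).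

Lemma shadow_max_transport n (s : {perm 'I_n}) (G H : rel 'I_n) (L : cdigraph k n) :
  (forall u v, G (s u) (s v) = H u v) -> is_shadow_of m L G ->
  is_shadow_of m ([ffun p => L (s p.1, s p.2)] : cdigraph k n) H.
Proof.
move=> GH /forallP h; apply/forallP => u; apply/forallP => v; apply/eqP.
rewrite -GH; have /forallP/(_ (s v))/eqP <- := h (s u).
by rewrite /shadow !ffunE /= (inj_eq perm_inj).
Qed.

Lemma shadow_max_iso_le n (s : {perm 'I_n}) (G H : rel 'I_n) : cdg_param g ->
  (forall u v, G (s u) (s v) = H u v) -> @has_shadow k m n G ->
  @has_shadow k m n H /\ shadow_max m g G <= shadow_max m g H.
Proof.
move=> [_ inv] GH hG; have [L hL ->] := shadow_max_attained g hG.
have hH := shadow_max_transport GH hL; split; first by exists [ffun p => L (s p.1, s p.2)].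
apply: le_trans (shadow_max_ge g hH).
by rewrite (inv n s L [ffun p => L (s p.1, s p.2)]) // => u v _; rewrite ffunE.
Qed.

Lemma shadow_max_none n (G : rel 'I_n) : ~ @has_shadow k m n G -> shadow_max m g G = 0.
Proof.
move=> h; rewrite /shadow_max; case: pickP => // L hL.
by case: h; exists L.
Qed.

Lemma has_shadowP n (G : rel 'I_n) :
  reflect (@has_shadow k m n G) [exists L : cdigraph k n, is_shadow_of m L G].
Proof. exact: existsP. Qed.

Lemma shadow_max_param : cdg_param g -> graph_param (shadow_max m g).
Proof.
move=> pg; split.
  case: (pg) => [[B hB] _]; exists `|B| => n G _.
  case: (has_shadowP G) => [/(shadow_max_attained g)[L _ ->]|h].
    exact: le_trans (hB n L) (ler_norm B).
  by rewrite shadow_max_none // normr0.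
move=> n s G H _ _ GH.
have HG u v : H ((s^-1)%g u) ((s^-1)%g v) = G u v by rewrite -GH !permKV.
case: (has_shadowP G) => [hG|nG].
  have [hH le1] := shadow_max_iso_le pg GH hG.
  have [_ le2] := shadow_max_iso_le pg HG hH.
  by apply/eqP; rewrite eq_le le1.
rewrite !shadow_max_none // => hH; apply: nG.
by have [] := shadow_max_iso_le pg HG hH.
Qed.

Lemma has_shadow_lt n (G : rel 'I_n) : (1 <= m)%N -> (m < k)%N -> simple_graph G ->
  @has_shadow k m n G.
Proof.
move=> hm mk [Gsym Girr].
pose a := Ordinal (leq_trans hm (ltnW mk) : (0 < k)%N); pose b := Ordinal mk.
exists [ffun p => if G p.1 p.2 then a else b].
apply/forallP => u; apply/forallP => v; rewrite /shadow !ffunE /= (Gsym v u).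
case: (eqVneq u v) => [->|_]; first by rewrite Girr.
by case: (G u v); rewrite /= ?hm ?ltnn.
Qed.

End Param.

(** For [m < k] every simple graph is a shadow. For [k = m] only complete graphs are, and the second
    claim is confined to graphs over which the maximum is taken over a nonempty set. *)
Theorem theorem2 (R : realType) (k m : nat) (hm : (1 <= m)%N) (hkm : (m <= k)%N)
    (g : forall n, cdigraph k n -> R) (hg : cdg_estimable g) :
  ((m < k)%N -> graph_estimable (shadow_max m g)) /\
  graph_estimable_on (@has_shadow k m) (shadow_max m g).
Proof.
suff main : graph_estimable_on (@has_shadow k m) (shadow_max m g).
  split=> // mk; case: main => pm est; split=> // eps delta e0 d0.
  have [r [r0 hr]] := est _ _ e0 d0; exists r; split=> // n G sG _ rn.
  by apply: hr => //; apply: has_shadow_lt.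
split; first by apply: shadow_max_param; case: hg.
move=> eps delta e0 d0; have d2 : 0 < delta / 2 by rewrite divr_gt0.
have [r1 h1] := shadow_max_upper hm hkm hg e0 d2.
have [r2 h2] := induced_test hg e0 d2.
exists (maxn r1 r2).+1; split=> // n G sG hG rn.
have le1 : (r1 <= (maxn r1 r2).+1)%N by rewrite leqW // leq_maxl.
have le2 : (r2 <= (maxn r1 r2).+1)%N by rewrite leqW // leq_maxr.
have [L hL gL] := shadow_max_attained g hG.
have -> : delta = delta / 2 + delta / 2 by field.
apply: prob_union (h1 _ _ G le1 rn sG hG) (h2 _ _ L le2 rn) => X _.
(* The restriction of the optimal [L] competes in the maximum for [X], so a value too low on [X]
   already makes [g] deviate on [L]; a value too high is the other event. *)
have := shadow_max_ge g (induced_shadow X hL); rewrite gL.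
set f := shadow_max _ _ _; set gX := g _ (induced_cdg L X); set gl := g _ L => lef.
case: (ltP (gl + eps) f) => //= le; rewrite !ltr_normr => /orP[] h; apply/orP; lra.
Qed.
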